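(* Suppose $\mathfrak p=(p_d)_{d\ge1}$ and $\mathfrak q=(q_d)_{d\ge1}$, with $p_d,q_d\in\mathcal P_d(\mathbb R)$, are two sequences of polynomials with infinitesimal distributions $(\mu,\mu')$ and $(\nu,\nu')$, respectively, where $\nu$ is supported on $[0,\infty)$. Then, for every $n\ge1$, the moments of $p_d\boxtimes_d q_d$ satisfy, as $d\to\infty$, $$m_n(p_d\boxtimes_d q_d)=m_n(\mu\boxtimes\nu)+\frac1d\,m_n'(\mathfrak p\boxtimes\mathfrak q)+o(1/d),$$ where $$m_n'(\mathfrak p\boxtimes\mathfrak q)=\sum_{\pi\in NC(n)}\Bigl(\sum_{V\in\pi}m'_{|V|}(\mathfrak p)\,m_{\pi\setminus V}(\mu)\cdot r_{Kr(\pi)}(\nu)+\sum_{W\in Kr(\pi)}m_\pi(\mu)\cdot\widehat r_{|W|}(\mathfrak q)\,r_{Kr(\pi)\setminus W}(\nu)\Bigr)-\frac n2\sum_{\substack{t+s=n\\ \sigma\in S_{NC}(t,s)}}\frac{m_\sigma(\mu)\,r_{Kr_{t,s}(\sigma)}(\nu)}{ts}.$$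
   Context: $\mathcal P_d(\mathbb R)$ is the set of monic real polynomials of degree $d$ with only real roots. For a monic real polynomial $p_d$ of degree $d$ with (complex) roots $\lambda_1,\dots,\lambda_d$ with multiplicity, $m_n(p_d)=\frac1d\sum_k\lambda_k^n$. Write $p_d(x)=\sum_{k=0}^d x^{d-k}(-1)^k\binom dk\mathsf e_k(p_d)$. The finite-free multiplicative convolution is $$[p_d\boxtimes_d q_d](x)=\sum_{k=0}^d x^{d-k}(-1)^k\binom dk\,\mathsf e_k(p_d)\,\mathsf e_k(q_d)$$ (real-rooted when, in addition, one of the factors has no negative roots). The finite-free cumulants are $\kappa_n(p_d)=\frac{(-d)^{n-1}}{(n-1)!}\sum_{\pi\in P(n)}(-1)^{|\pi|-1}(|\pi|-1)!\prod_{V\in\pi}\mathsf e_{|V|}(p_d)$, $1\le n\le d$, with $P(n)$ the set of partitions of $[n]=\{1,\dots,n\}$ and $|\pi|$ the number of blocks. A sequence $\mathfrak p$ has infinitesimal distribution $(\mu,\mu')$ if $\mu$ is a probability distribution on $\mathbb R$ with finite moments $m_n(\mu)$ of all orders, $m_n(p_d)\to m_n(\mu)$ for all $n\ge0$, the infinitesimal moments $m_n'(\mathfrak p)=\lim_{d\to\infty}d\,(m_n(p_d)-m_n(\mu))$ exist for all $n\ge1$, and $\mu':\mathbb R[x]\to\mathbb R$ is the linear functional with $\mu'(1)=0$, $\mu'(x^n)=m_n'(\mathfrak p)$. The cumulant fluctuations of such $\mathfrak p$ are the numbers $\widehat r_n(\mathfrak p)$ with $\kappa_n(p_d)=r_n(\mu)+\frac1d\widehat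 r_n(\mathfrak p)+o(1/d)$ as $d\to\infty$ (they always exist). $NC(n)$ is the set of non-crossing partitions of $[n]$. For a sequence $(u_n)$: $u_\pi=\prod_{V\in\pi}u_{|V|}$, $u_{\pi\setminus V}=\prod_{W\in\pi,W\neq V}u_{|W|}$, $u_\sigma=\prod_c u_{|c|}$ over cycles $c$ (fixed points included) of a permutation $\sigma$. For $\pi\in NC(n)$, $Kr(\pi)\in NC(n)$ is the Kreweras complement: viewing $\pi$ as the permutation whose cycles are its blocks in increasing order and $\gamma_n=(1,2,\dots,n)$, $Kr(\pi)$ is the partition whose blocks are the cycles of $\pi^{-1}\gamma_n$. Free cumulants $r_n(\mu)$ are defined recursively by $m_n(\mu)=\sum_{\pi\in NC(n)}r_\pi(\mu)$. Throughout, only distributions determined by their moments are considered; for $\nu$ supported on $[0,\infty)$, the free multiplicative convolution $\mu\boxtimes\nu$ is the probability measure with $r_n(\mu\boxtimes\nu)=\sum_{\pi\in NC(n)}r_\pi(\mu)\,r_{Kr(\pi)}(\nu)$ for all $n\ge1$. For $t,s\ge1$ let $\gamma_{t,s}=(1,\dots,t)(t+1,\dots,t+s)\in S_{t+s}$; $S_{NC}(t,s)$ is the set of $\sigma\in S_{t+s}$ such that $\langle\sigma,\gamma_{t,s}\rangle$ acts transitively on $[t+s]$ and $|\sigma|+|\sigma^{-1}\gamma_{t,s}|=t+s$, $|\cdot|$ counting cycles including fixed points; $Kr_{t,s}(\sigma)=\sigma^{-1}\gamma_{t,s}$. Sums over $t+s=n$ run over ordered pairs of integers $t,s\ge1$.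 *)

(* Defs.v *)
From mathcomp Require Import all_boot all_order all_fingroup all_algebra.

Set Implicit Arguments.
Unset Strict Implicit.
Unset Printing Implicit Defensive.

Import Order.TTheory GRing.Theory Num.Theory.

Local Open Scope ring_scope.

Section Partitions.
Variable n : nat.
Implicit Types (P : {set {set 'I_n}}) (i : 'I_n).

Definition set_partitions : {set {set {set 'I_n}}} :=
  [set P | partition P [set: 'I_n]].

Definition noncrossing P : bool :=
  [forall A in P, forall B in P,
    [exists a in A, exists b in B, exists c in A, exists d in B,
      [&& (a < b)%N, (b < c)%N & (c < d)%N]] ==> (A == B)].

Definition NC : {set {set {set 'I_n}}} :=
  [set P in set_partitions | noncrossing P].

(* [enum] lists a set of ordinals in increasing order *)
Definition block_succ P i : 'I_n := next (enum (pblock P i)) i.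

(* the default 1 is not used when P is a partition, see block_permE *)
Definition block_perm P : 'S_n := insubd (1%g : 'S_n) [ffun i => block_succ P i].

Definition long_cycle : 'S_n := perm (@ordS_inj n).

(* MathComp composes permutations from left to right: (s * t) i = t (s i) *)
Definition Kr P : {set {set 'I_n}} := porbits (long_cycle * (block_perm P)^-1)%g.

Lemma pblock_partition P i : partition P [set: 'I_n] ->
  (pblock P i \in P) * (i \in pblock P i).
Proof.
move=> /and3P[/eqP cP _ _].
have iP : i \in cover P by rewrite cP inE.
by rewrite pblock_mem // mem_pblock.
Qed.

Lemma block_permE P i : partition P [set: 'I_n] ->
  block_perm P i = block_succ P i.
Proof.
move=> pP; have /and3P[_ tP _] := pP.
have succP j : block_succ P j \in pblock P j.
  by rewrite -mem_enum mem_next mem_enum (pblock_partition j pP).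
have sameP j : pblock P (block_succ P j) = pblock P j.
  by apply: same_pblock; rewrite ?succP.
have injP : injectiveb [ffun j => block_succ P j].
  apply/injectiveP => j k; rewrite !ffunE => ejk.
  have epb : pblock P j = pblock P k by rewrite -(sameP j) -(sameP k) ejk.
  have := congr1 (prev (enum (pblock P j))) ejk.
  by rewrite /block_succ -epb !prev_next // enum_uniq.
by rewrite -pvalE /block_perm insubdK // ffunE.
Qed.

End Partitions.

Section Annular.
Variables t s : nat.

Definition two_cycles_fun (i : 'I_(t + s)) : 'I_(t + s) :=
  match fintype.split i with
  | inl j => lshift s (ordS j)
  | inr k => rshift t (ordS k)
  end.

Lemma two_cycles_inj : injective two_cycles_fun.
Proof.
move=> i j; rewrite /two_cycles_fun -{2}(splitK i) -{2}(splitK j).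
case: (fintype.split i) => a; case: (fintype.split j) => b /=.
- by move=> /lshift_inj/ordS_inj ->.
- by move=> /eqP; rewrite eq_lrshift.
- by move=> /eqP; rewrite eq_rlshift.
- by move=> /rshift_inj/ordS_inj ->.
Qed.

Definition two_cycles : 'S_(t + s) := perm two_cycles_inj.

Definition Kr_ann (sigma : 'S_(t + s)) : 'S_(t + s) :=
  (two_cycles * sigma^-1)%g.

Definition SNC : {set 'S_(t + s)} :=
  [set sigma |
    [transitive <<[set sigma; two_cycles]>>%g, on [set: 'I_(t + s)] | 'P] &&
    (#|porbits sigma| + #|porbits (Kr_ann sigma)| == t + s)%N].

End Annular.

Section MultiplicativeExtension.
Variables (R : comNzRingType) (u : nat -> R) (T : finType).

Definition mult_ext (P : {set {set T}}) : R := \prod_(V in P) u #|V|.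

Definition mult_ext_perm (sigma : {perm T}) : R := mult_ext (porbits sigma).

End MultiplicativeExtension.

Section FreeCumulants.
Variables (R : comNzRingType) (m : nat -> R).

(* m_n = \sum_(P in NC n) r_P is solved for the term P = {[n]}, which is r_n;
   the entry of index 0 is a placeholder. *)
Fixpoint free_cumulant_seq (n : nat) : seq R :=
  if n is n'.+1 then
    let r := free_cumulant_seq n' in
    rcons r (m n - \sum_(P in NC n | P != [set [set: 'I_n]])
                      mult_ext (nth 0 r) P)
  else [:: 0].

Definition free_cumulant (n : nat) : R := nth 0 (free_cumulant_seq n) n.

Lemma size_free_cumulant_seq n : size (free_cumulant_seq n) = n.+1.
Proof. by elim: n => //= n IH; rewrite size_rcons IH. Qed.

Lemma nth_free_cumulant_seq n k : (k <= n)%N ->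
  nth 0 (free_cumulant_seq n) k = free_cumulant k.
Proof.
elim: n => [|n IH]; first by rewrite leqn0 => /eqP ->.
rewrite leq_eqVlt => /orP[/eqP -> //|kn].
by rewrite /= nth_rcons size_free_cumulant_seq kn IH.
Qed.

Lemma trivial_partition_NC n : [set [set: 'I_n.+1]] \in NC n.+1.
Proof.
rewrite !inE; apply/andP; split; last first.
  apply/forall_inP => A; rewrite inE => /eqP ->.
  apply/forall_inP => B; rewrite inE => /eqP ->.
  by rewrite eqxx implybT.
rewrite /partition /cover big_set1 eqxx /=; apply/andP; split.
  apply/trivIsetP => A B; rewrite !inE => /eqP -> /eqP ->.
  by rewrite eqxx.
by rewrite inE eq_sym -card_gt0 cardsT card_ord.
Qed.

Lemma moment_free_cumulant n : (0 < n)%N ->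
  m n = \sum_(P in NC n) mult_ext free_cumulant P.
Proof.
case: n => // n _.
rewrite (bigD1 _ (trivial_partition_NC n)) /= {1}/mult_ext big_set1.
rewrite cardsT card_ord {1}/free_cumulant /=.
rewrite nth_rcons size_free_cumulant_seq ltnn eqxx.
rewrite -[LHS](subrK (\sum_(P in NC n.+1 | P != [set [set: 'I_n.+1]])
  mult_ext (nth 0 (free_cumulant_seq n)) P)); congr (_ + _).
apply: eq_bigr => P /andP[]; rewrite inE => /andP[]; rewrite inE => pP _ nP.
apply: eq_bigr => V VP; apply: nth_free_cumulant_seq.
rewrite -ltnS ltn_neqAle -[X in (_ <= X)%N]card_ord max_card andbT.
apply: contraNneq nP => cV.
have VT : V = [set: 'I_n.+1].
  by apply/eqP; rewrite eqEcard subsetT cardsT card_ord cV /=.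
rewrite eqEsubset andbC sub1set -VT VP /=.
apply/subsetP => B BP; rewrite inE; apply: contraT => BV.
have /and3P[_ /trivIsetP tP P0] := pP.
have /= := tP _ _ BP VP BV; rewrite VT -setI_eq0 setIT => /eqP B0.
by rewrite B0 (negbTE P0) in BP.
Qed.

End FreeCumulants.

(* imported only here: the set notations of classical_sets hide those of
   finset *)
From mathcomp Require Import complex.
From mathcomp Require Import all_classical all_reals all_analysis.

Import numFieldNormedType.Exports.

Local Open Scope classical_set_scope.

Section FiniteFree.
Variable R : realType.
Implicit Types (d n k : nat) (p q : {poly R}).

Definition real_rooted d p : Prop :=
  [/\ p \is monic, size p = d.+1 &
      forall z : R[i], root (map_poly (real_complex R) p) z -> complex.Im z = 0].

Definition complex_roots p : seq R[i] :=
  sval (closed_field_poly_normal (map_poly (real_complex R) p)).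

(* The power sums of the complex roots of a real polynomial are real numbers
   (complex_moment_real); Re only changes their type. *)
Definition complex_moment d p n : R[i] :=
  (\sum_(z <- complex_roots p) z ^+ n) / d%:R.

Definition poly_moment d p n : R := complex.Re (complex_moment d p n).

Definition nesym d p k : R := (-1) ^+ k * p`_(d - k) / 'C(d, k)%:R.

Definition fmul_conv d p q : {poly R} :=
  \sum_(k < d.+1)
    ((-1) ^+ k * 'C(d, k)%:R * nesym d p k * nesym d q k) *: 'X^(d - k).

Definition finite_free_cumulant d p n : R :=
  (- d%:R) ^+ n.-1 / n.-1`!%:R *
  \sum_(P in set_partitions n)
    (-1) ^+ #|P|.-1 * #|P|.-1`!%:R * mult_ext (nesym d p) P.

Lemma complex_rootsE p : p \is monic ->
  map_poly (real_complex R) p = \prod_(z <- complex_roots p) ('X - z%:P).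
Proof.
move=> mp; rewrite /complex_roots; case: closed_field_poly_normal => r /= {1}->.
have -> : lead_coef (map_poly (real_complex R) p) = 1.
  by apply/eqP; rewrite -monicE map_monic.
by rewrite scale1r.
Qed.

Lemma nesymE d p : size p = d.+1 ->
  p = \sum_(k < d.+1) ((-1) ^+ k * 'C(d, k)%:R * nesym d p k) *: 'X^(d - k).
Proof.
move=> sp; rewrite -[LHS]coefK poly_def sp (reindex_inj rev_ord_inj) /=.
apply: eq_bigr => k _; rewrite subSS; congr (_ *: _).
have C0 : 'C(d, k)%:R != 0 :> R.
  by rewrite pnatr_eq0 -lt0n bin_gt0 -ltnS.
rewrite /nesym mulrACA divff // mulr1 mulrA -expr2 sqrr_sign mul1r.
by [].
Qed.

Lemma complex_moment_real d p n : p \is monic ->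
  complex_moment d p n = real_complex R (poly_moment d p n).
Proof.
move=> mp; have perm_conj :
    perm_eq (map conjc (complex_roots p)) (complex_roots p).
  apply: prod_XsubC_eq; rewrite -complex_rootsE // big_map.
  rewrite -(map_prod_XsubC conjc) -complex_rootsE // -map_poly_comp.
  by apply: eq_map_poly => x /=; rewrite oppr0.
have conjM : conjc (complex_moment d p n) = complex_moment d p n.
  rewrite /complex_moment rmorphM /= fmorphV /= rmorph_nat rmorph_sum /=.
  rewrite -[in RHS](perm_big _ perm_conj) /= big_map.
  by congr (_ / _); apply: eq_bigr => z _; rewrite rmorphXn.
rewrite /poly_moment; case: (complex_moment d p n) conjM => a b [] /eqP.
by rewrite eq_sym -addr_eq0 -mulr2n mulrn_eq0 /= => /eqP ->.
Qed.

End FiniteFree.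

Section Distributions.
Variable R : realType.
Implicit Types (mu nu rho : probability (measurableTypeR R) R) (n : nat).

Definition moment mu n : R := \int[mu]_x (x ^+ n).

Definition finite_moments mu : Prop :=
  forall n, mu.-integrable [set: measurableTypeR R] (fun x => (x ^+ n)%:E).

Definition moment_determinate mu : Prop :=
  forall nu, finite_moments nu -> (forall n, moment nu n = moment mu n) ->
  forall A : set (measurableTypeR R), measurable A -> nu A = mu A.

Definition supported_nneg mu : Prop := mu [set x | x < 0] = 0%E.

Definition free_cumulant_of mu : nat -> R := free_cumulant (moment mu).

Definition is_free_mul_conv mu nu rho : Prop :=
  finite_moments rho /\
  forall n, (0 < n)%N ->
    free_cumulant_of rho n =
    \sum_(P in NC n)
      mult_ext (free_cumulant_of mu) P * mult_ext (free_cumulant_of nu) (Kr P).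

End Distributions.

Section InfinitesimalDistributions.
Variable R : realType.
Implicit Types (p : nat -> {poly R}) (mu : probability (measurableTypeR R) R).

(* u d = a + b / d + o(1 / d) *)
Definition first_order_expansion (u : nat -> R) (a b : R) : Prop :=
  (fun d => u d - (a + b / d%:R) : R^o) =o_\oo (fun d => d%:R^-1 : R^o).

Lemma first_order_expansionP u a b :
  first_order_expansion u a b <->
  (d%:R * (u d - a) @[d --> \oo] --> b).
Proof.
have eqn d : (0 < d)%N -> (u d - (a + b / d%:R)) * d%:R = d%:R * (u d - a) - b.
  move=> d0; have d1 : d%:R != 0 :> R by rewrite pnatr_eq0 -lt0n.
  by rewrite opprD addrA mulrBl divfK // mulrC.
have normE e (x : R) d : (0 < d)%N ->
    (`|x| <= e * `|(d%:R^-1 : R)|) = (`|x * d%:R| <= e).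
  move=> d0; have dR : 0 < d%:R :> R by rewrite ltr0n.
  by rewrite normfV normrM (gtr0_norm dR) ler_pdivlMr.
split=> [/eqoP h|h].
  apply/cvgrPdist_le => e e0; near=> d.
  have d0 : (0 < d)%N by near: d; exists 1%N.
  rewrite distrC -eqn // -normE //.
  by near: d; exact: h.
apply/eqoP => e e0; near=> d.
have d0 : (0 < d)%N by near: d; exists 1%N.
apply: (etrans (normE e _ d d0)).
rewrite eqn // distrC.
by near: d; move/cvgrPdist_le : h; exact.
Unshelve. all: by end_near. Qed.

Definition has_inf_distribution p mu (mu' : {scalar {poly R}}) : Prop :=
  [/\ finite_moments mu,
      forall n, poly_moment d (p d) n @[d --> \oo] --> moment mu n,
      mu' 1 = 0 &
      forall n, (0 < n)%N ->
        d%:R * (poly_moment d (p d) n - moment mu n) @[d --> \oo]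
          --> mu' 'X^n].

Definition cumulant_fluctuation p mu (n : nat) : R :=
  get [set r | first_order_expansion
    (fun d => finite_free_cumulant d (p d) n) (free_cumulant_of mu n) r].

Definition inf_moment_mul_conv mu (mu' : {scalar {poly R}})
    (q : nat -> {poly R}) (nu : probability (measurableTypeR R) R) (n : nat) : R :=
  let m := moment mu in
  let m' k := mu' 'X^k in
  let r := free_cumulant_of nu in
  let r' := cumulant_fluctuation q nu in
  \sum_(P in NC n)
    (\sum_(V in P) m' #|V| * mult_ext m (P :\ V) * mult_ext r (Kr P)
     + \sum_(W in Kr P) mult_ext m P * (r' #|W| * mult_ext r (Kr P :\ W)))
  - n%:R / 2 *
    \sum_(1 <= t < n) \sum_(sigma in SNC t (n - t)%N)
      mult_ext_perm m sigma * mult_ext_perm r (Kr_ann sigma)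
        / (t%:R * (n - t)%N%:R).

End InfinitesimalDistributions.

(* Main.v *)
Require Import Defs.
From mathcomp Require Import all_boot all_order all_fingroup all_algebra.
From mathcomp Require Import zify ring.

(** Attach to every cycle of length k of a permutation the signed weight
    (-1)^(k-1) d u_k.  Summing the products of these weights over all
    permutations of k points gives k! times an elementary symmetric function
    of the roots when u is the sequence of moments (Newton's identities,
    [perm_sum_moment]), d^k e_k when u is the sequence of finite free cumulants
    (because their definition is the logarithm of the sequence e,
    [perm_sum_cumulant]), and the falling factorial of d when u = 1
    ([perm_sum_one]).  Finite free multiplicative convolution multiplies the
    coefficients e_k, so the sum for the moments of the convolution of p and q,
    times d^k, is the product of the sum for the moments of p and the sum for
    the cumulants of q.

    A product of two sums over permutations is a sum over pairs (s, t), and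
    cutting along the orbit of one point under the group generated by s and t
    ([perm_sum_mul]) isolates the connected part on both sides ([conn_sum_eq]).
    This gives an exact formula for every d >= n ([moment_fmul_conv]): the n-th
    moment of the convolution is the sum over the pairs generating a transitive
    group of (-1/d)^(n + 1 - |s| - |t|) m_s(p) kappa_t(q), divided by (n-1)!
    ([transitive_sum]); here |s| is the number of cycles of s, and products of
    permutations are read from left to right.

    For a transitive pair the genus bound |s| + |t| + |ts| <= n + 2 holds
    ([coloured_genus_bound]).  Hence the exponent of 1/d is nonnegative; if it
    is 0 then ts is an n-cycle, and if it is 1 then ts has exactly two cycles, a
    single cycle being excluded by parity.  Conjugating ts to a standard
    n-cycle, the terms of exponent 0 are the geodesics from 1 to the long cycle,
    which are the noncrossing partitions ([sum_geodesic]); conjugating it to a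
    standard product of two cycles, the terms of exponent 1 are the annular
    noncrossing permutations, weighted by -n/2 over the product of the two cycle
    lengths ([transitive_sum_split]).  The rest is O(1/d^2), and the product rule for
    expansions a + b/d + o(1/d) produces the two sums over blocks
    ([expands_transitive_sum]).

    The cumulants enter through two more instances of the exact formula.  With
    the cumulants of p and the constant 1 it yields the moments of p
    ([moment_of_cumulants]); solving it for the top cumulant shows that the
    cumulants have expansions, and its limit is the moment-cumulant relation,
    so the limits are the free cumulants ([cumulant_expands]).  With the
    cumulants of p and those of q it yields the cumulants of the convolution
    ([cumulant_fmul_conv]).  Taking limits of all three identifies the leading
    term with the moment of the free multiplicative convolution
    ([moment_mul_conv]) without any computation in the lattice of noncrossing
    partitions. *)

Set Implicit Arguments.
Unset Strict Implicit.
Unset Printing Implicit Defensive.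

Import Order.TTheory GRing.Theory Num.Theory.

(** * Cycles of a product of two permutations *)

(** Cardinals that are equal only up to unfolding are first named, so that [lia]
    sees them as the same unknown. *)
Ltac card_lia := repeat (let k := fresh "k" in set k := #|_|; clearbody k); lia.

Section Genus.
Variable T : finType.
Implicit Types (s t : {perm T}) (x y z : T).
Local Open Scope group_scope.

Lemma porbit_const (U : Type) (c : T -> U) s x y :
  (forall z, c (s z) = c z) -> y \in porbit s x -> c y = c x.
Proof.
move=> cs /porbitP[i ->]; elim: i => [|i IH]; first by rewrite perm1.
by rewrite expgSr permM cs.
Qed.

Lemma porbit_stable (A : {pred T}) s x y :
  (forall z, z \in A -> s z \in A) -> x \in A -> y \in porbit s x -> y \in A.
Proof.
move=> sA xA /porbitP[i ->]; elim: i => [|i IH]; first by rewrite perm1.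
by rewrite expgSr permM sA.
Qed.

Lemma porbit_step s x : s x \in porbit s x.
Proof. by rewrite -{1}(expg1 s) mem_porbit. Qed.

Lemma porbit_stepV s x : s^-1 x \in porbit s x.
Proof. by have := porbit_step s (s^-1 x); rewrite permKV porbit_sym. Qed.

Lemma porbit_eqP s x y : reflect (porbit s x = porbit s y) (x \in porbit s y).
Proof. by rewrite -eq_porbit_mem; apply: eqP. Qed.

Lemma card_porbits1 : #|porbits (1 : {perm T})| = #|T|.
Proof.
rewrite card_imset // => x y /eqP.
by rewrite eq_porbit_mem => /porbitP[i ->]; rewrite expg1n perm1.
Qed.

Lemma card_porbits_max s : #|porbits s| = #|T| -> s = 1.
Proof.
move=> /eqP/imset_injP injs; apply/permP => x; rewrite perm1.
by apply: injs => //; apply/porbit_eqP/porbit_step.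
Qed.

(** Multiplication by a transposition cuts a cycle through both points in two;
    [card_porbits_join] is the opposite case. *)
Lemma card_porbits_cut s x y : x != y -> x \in porbit s y ->
  #|porbits (tperm x y * s)| = #|porbits s|.+1.
Proof.
by move=> xy xsy; have := porbits_mul_tperm s x y; rewrite xsy xy /= addn0 addn1.
Qed.

Lemma card_porbits_join s x y : x \notin porbit s y ->
  #|porbits (tperm x y * s)|.+1 = #|porbits s|.
Proof.
move=> xsy; have := porbits_mul_tperm s x y; rewrite xsy /=.
have -> /= : x != y by apply: contraNneq xsy => ->; rewrite porbit_id.
lia.
Qed.

(** The Euler characteristic inequality |s| + |t| + |ts| <= n + 2 (number of
    orbits of the group generated by s and t).  The orbits are replaced by the
    fibres of an invariant colouring [c], which is all that the induction
    maintains: t is built up by transpositions, each of which lowers the number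
    of cycles of t by one.  If it joins two colours, it also joins two cycles of
    ts; otherwise it changes the number of cycles of ts by one in either
    direction.  A transitive pair only has constant invariant colourings. *)
Lemma coloured_genus_bound s t : exists c : T -> {set T},
  [/\ forall z, c (s z) = c z, forall z, c (t z) = c z &
      #|porbits s| + #|porbits t| + #|porbits (t * s)|
        <= #|T| + #|c @: T|.*2].
Proof.
move: {2}(#|T| - #|porbits t|) (leqnn (#|T| - #|porbits t|)) => m.
elim: m t => [|m IH] t.
  rewrite leqn0 subn_eq0 => tT.
  have -> : t = 1 by apply/card_porbits_max/eqP; rewrite eqn_leq tT leq_imset_card.
  exists (porbit s); split=> [z|z|]; rewrite ?perm1 //.
    exact/porbit_eqP/porbit_step.
  by rewrite mul1g card_porbits1 /porbits; lia.
case: (pickP (fun x => t x != x)) => [x tx|t1] mt; last first.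
  apply: IH; have -> : t = 1 by apply/permP => x; rewrite perm1; apply/eqP/negPn; rewrite t1.
  by rewrite card_porbits1 subnn.
pose y := t x; have [t0 et0] : exists t0 : {perm T}, t0 = tperm x y * t by eexists.
have et : t = tperm x y * t0 by rewrite et0 mulgA tperm2 mul1g.
have ct0 : #|porbits t0| = #|porbits t|.+1.
  by rewrite et0; apply: card_porbits_cut; [rewrite eq_sym | rewrite porbit_sym porbit_step].
have [|c [cs ct0' gb]] := IH t0; first by lia.
have cts z : c ((t0 * s) z) = c z by rewrite permM cs.
have xy : x != y by rewrite eq_sym; exact: tx.
have /= ets := porbits_mul_tperm (t0 * s) x y.
rewrite mulgA -et xy addn1 in ets.
(* the colour of x is merged into that of y *)
exists (fun z => if c z == c x then c y else c z); split.
- by move=> z; rewrite cs.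
- move=> z; rewrite et permM ct0'.
  by case: tpermP => [->|->|//]; rewrite ?eqxx; case: eqP.
have [exy|nxy] := eqVneq (c x) (c y).
  set c' := fun z => _; have -> : c' @: T = c @: T.
    by apply: eq_imset => z; rewrite /c'; case: eqP => // ->.
  by move: ct0 gb ets; case: (x \notin _) => /=; card_lia.
have nx : x \notin porbit (t0 * s) y.
  by apply: contraNN nxy => /(porbit_const cts) ->.
rewrite nx in ets.
set c' := fun z => _.
have sub : c @: T :\ c x \subset c' @: T.
  apply/subsetP => A; rewrite !inE => /andP[nA /imsetP[z _ eA]].
  by apply/imsetP; exists z; rewrite // /c' -eA (negPf nA).
move: (subset_leq_card sub); move: gb; rewrite [#|c @: T|](cardsD1 (c x)) imset_f //.
by move: ct0 ets => /=; card_lia.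
Qed.

(** The triangle inequality for the length n - |s|.  It follows from the genus
    bound because an invariant colouring is constant on the cycles of ts, hence
    has at most |ts| colours. *)
Lemma card_porbits_mul s t :
  #|porbits s| + #|porbits t| <= #|T| + #|porbits (t * s)|.
Proof.
have [c [cs ct]] := coloured_genus_bound s t.
suff : #|c @: T| <= #|porbits (t * s)| by lia.
have cts z : c ((t * s) z) = c z by rewrite permM cs.
(* the colour of a cycle of ts, read off at any of its points *)
pose h (A : {set T}) := if [pick x in A] is Some x then c x else set0.
have -> : c @: T = h @: porbits (t * s).
  rewrite /porbits -imset_comp; apply: eq_imset => x /=.
  rewrite /h; case: pickP => [y|/(_ x)]; last by rewrite porbit_id.
  by move=> /(porbit_const cts).
exact: leq_imset_card.
Qed.

End Genus.

(** * Noncrossing partitions as geodesics to the long cycle *)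

Section LongCycleValues.
Variable n : nat.
Implicit Types (i j z : 'I_n) (A : {set 'I_n}).
Local Open Scope group_scope.

Lemma val_long_cycle i : long_cycle n i = i.+1 %% n :> nat.
Proof. by rewrite permE. Qed.

Lemma val_long_cycleV i : 0 < i -> (long_cycle n)^-1 i = i.-1 :> nat.
Proof.
move=> i0; have lt : i.-1 < n by have := ltn_ord i; lia.
suff -> : (long_cycle n)^-1 i = Ordinal lt by [].
apply: (canLR (permK (long_cycle n))); apply: ord_inj.
by apply: etrans (esym (val_long_cycle _)); rewrite /= prednK // modn_small.
Qed.

End LongCycleValues.

Lemma porbit_long_cycle n (i : 'I_n) : porbit (long_cycle n) i = setT.
Proof.
case: n i => [[]//|m] i; have zi k : (k < m.+1)%N -> inord k \in porbit (long_cycle m.+1) ord0.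
  elim: k => [|k IH] km.
    by rewrite (_ : inord 0 = ord0) ?porbit_id //; apply: ord_inj; rewrite /= inordK.
  have -> : inord k.+1 = long_cycle m.+1 (inord k) :> 'I_m.+1.
    by apply: ord_inj; rewrite val_long_cycle !inordK ?modn_small //; lia.
  have /porbit_eqP <- := IH (ltnW km).
  exact: porbit_step.
have z0 (j : 'I_m.+1) : j \in porbit (long_cycle m.+1) ord0 by rewrite -(inord_val j) zi.
by apply/setP => j; rewrite inE; have /porbit_eqP-> := z0 i; rewrite z0.
Qed.

Lemma card_porbits_long_cycle n : 0 < n -> #|porbits (long_cycle n)| = 1%N.
Proof.
case: n (@porbit_long_cycle n) => // m pl _.
rewrite /porbits (eq_imset _ pl) -(cards1 [set: 'I_m.+1]); congr #|pred_of_set _|.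
by apply/setP => A; rewrite inE; apply/imsetP/eqP => [[]//|->]; exists ord0.
Qed.

Section Intervals.
Variable n : nat.
Implicit Types (i j z : 'I_n) (A : {set 'I_n}).
Local Open Scope group_scope.

(** Cutting the long cycle at i and j leaves the cyclic interval [i, j) as one of
    the two cycles; this is the only way in which the cyclic order of the points
    enters the analysis of geodesics. *)
Lemma interval_stable i j z (s := tperm i j * (long_cycle n)^-1) :
  i < j -> i <= z < j -> i <= s z < j.
Proof.
move=> ij /andP[iz zj]; rewrite /s permM; case: tpermP => [_|zj'|/eqP zi _].
- by rewrite val_long_cycleV; lia.
- by rewrite zj' ltnn in zj.
- have {}zi : z != i :> nat by [].
  by rewrite val_long_cycleV; lia.
Qed.

(** The enumeration of a set of ordinals is increasing, so the cyclic successor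
    only descends at the maximum, and there it goes to the minimum. *)
Lemma next_enumP A i (j := next (enum A) i) : i \in A ->
  j \in A /\ ((i < j /\ forall z, z \in A -> ~~ (i < z < j)) \/
              (j <= i /\ forall z, z \in A -> j <= z <= i)).
Proof.
move=> iA; have is_ : i \in enum A by rewrite mem_enum.
split; first by rewrite /j -mem_enum mem_next.
have srt : sorted (fun x y : 'I_n => (x < y)%N) (enum A).
  rewrite /enum_mem -enumT /=; apply: sorted_filter.
    by move=> x y w; apply: ltn_trans.
  by rewrite -(@sorted_map _ _ val ltn) val_enum_ord iota_ltn_sorted.
have nthlt a b : (a < b)%N -> (b < size (enum A))%N ->
    nth i (enum A) a < nth i (enum A) b.
  move=> ab bs; apply: (sorted_ltn_nth _ i srt) => //.
    by move=> x y w; apply: ltn_trans.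
  by rewrite inE (ltn_trans ab).
have nthle a b : (a <= b)%N -> (b < size (enum A))%N ->
    nth i (enum A) a <= nth i (enum A) b.
  by rewrite leq_eqVlt => /orP[/eqP->//|ab] bs; rewrite ltnW // nthlt.
have := next_nth (enum A) i; rewrite is_ -/j.
move: is_; set k := index i (enum A); rewrite -index_mem -/k => ks.
have nk : nth i (enum A) k = i by rewrite nth_index // -index_mem.
have inA z : z \in A -> exists2 a, (a < size (enum A))%N & z = nth i (enum A) a.
  by rewrite -mem_enum => /(nthP i)[a as_ <-]; exists a.
case e : (enum A) => [|y p] ej; first by rewrite e in ks.
have ejn : j = nth y (enum A) k.+1 by rewrite e.
have [ks'|ks'] := ltnP k.+1 (size (enum A)).
  left; rewrite ejn (set_nth_default i) //; split.
    by rewrite -{1}nk nthlt.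
  move=> z /inA[a as_ ->]; rewrite -{1}nk; apply/negP => /andP[h1 h2].
  have [ak|ka] := leqP a k; first by have := nthle _ _ ak ks; lia.
  by have := nthle _ _ ka as_; lia.
right; have e0 : j = nth i (enum A) 0.
  by rewrite ejn nth_default // e.
split; first by rewrite e0 -{2}nk nthle.
move=> z /inA[a as_ ->]; rewrite e0 nthle //=.
by rewrite -{2}nk nthle // -ltnS (leq_trans as_).
Qed.

Lemma next_enum_uniq A i j : i \in A -> j \in A -> (i = j -> A = [set i]) ->
    (i < j -> forall z, z \in A -> ~~ (i < z < j)) ->
    (j < i -> forall z, z \in A -> j <= z <= i) ->
  next (enum A) i = j.
Proof.
move=> iA jA eij lij lji; have [] := next_enumP iA.
set k := next _ _ => kA h; apply: ord_inj => /=.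
case: (ltngtP i j) => [ij|ji|/val_inj/eij eA]; last first.
- move: kA jA; rewrite eA !inE => /eqP-> /eqP->//.
- by case: h => [[h1 h2]|[h1 h2]]; move: (lji ji _ kA) (h2 _ jA); lia.
- by case: h => [[h1 h2]|[h1 h2]]; move: (lij ij _ kA) (h2 _ jA); lia.
Qed.

(** The point s lies on a geodesic from 1 to the long cycle for the distance
    given by the length n - |s|. *)
Definition geodesic (s : 'S_n) : bool :=
  #|porbits s| + #|porbits (long_cycle n * s^-1)| == n.+1.

(** A form of noncrossing that survives the removal of a point from a cycle: what
    lies below an ascent of s stays below it. *)
Definition climbs_stably (s : 'S_n) : Prop :=
  forall i z, i < s i -> i < z < s i -> i < s z < s i.

Lemma climb_or_id (s : 'S_n) : s != 1 -> exists i, i < s i.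
Proof.
move=> s1; apply/existsP; apply: contraNT s1 => /existsPn le.
apply/eqP/permP => i; rewrite perm1.
suff h m (j : 'I_n) : j < m -> s j = j by exact: h (ltn_ord i).
elim: m j => // m IH j jm; have := le j; rewrite -leqNgt leq_eqVlt => /orP[/eqP/ord_inj//|sj].
by apply: (@perm_inj _ s); apply: IH; lia.
Qed.

(** Split off from its cycle a point a with a < s a = b.  The number of cycles of
    s grows by one.  The interval [a, b) is stable under the Kreweras complement
    of s, contains a and does not contain the preimage of a under s, so the
    complement loses one cycle in the step.  The total is unchanged, and the
    process ends at the identity, whose complement is the long cycle. *)
Lemma climbs_stably_geodesic (s : 'S_n) : 0 < n -> climbs_stably s -> geodesic s.
Proof.
move=> n0; move: {2}(n - #|porbits s|) (leqnn (n - #|porbits s|)) => m.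
elim: m s => [|m IH] s sm st.
  have -> : s = 1.
    apply/card_porbits_max/eqP; rewrite eqn_leq leq_imset_card card_ord.
    by rewrite -subn_eq0 -leqn0.
  by rewrite /geodesic invg1 mulg1 card_porbits1 card_porbits_long_cycle // card_ord addn1.
have [->|/climb_or_id[a ab]] := eqVneq s 1.
  by rewrite /geodesic invg1 mulg1 card_porbits1 card_porbits_long_cycle // card_ord addn1.
have [c sc] : exists c, s c = a by exists (s^-1 a); rewrite permKV.
have [b sb] : exists b, s a = b by eexists.
have ca : c != a by apply: contraTneq ab => e; rewrite -{2}e sc ltnn.
rewrite sb in ab.
have sta z : a < z < b -> a < s z < b by have := st a z; rewrite sb; apply.
have [s' es'] : exists s', s' = tperm c a * s by eexists.
have cs' : #|porbits s'| = #|porbits s|.+1.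
  by rewrite es' card_porbits_cut // porbit_sym -{1}sc porbit_step.
have s'E x : s' x = if x == c then b else if x == a then a else s x.
  rewrite es' permM; case: tpermP => [->|->|/eqP/negPf-> /eqP/negPf->//].
    by rewrite eqxx sb.
  by rewrite eq_sym (negPf ca) eqxx.
(* s sends c to a, so c cannot lie in the stable interval *)
have cNab : ~~ (a <= c < b).
  apply/negP => h; have cav : c != a :> nat by [].
  by have := sta c; rewrite sc ltnn /=; lia.
have st' : climbs_stably s'.
  move=> p x; rewrite !s'E.
  have [->|pc] := eqVneq p c.
    move=> cb /andP[cx xb]; have xc : x != c by apply: contraTneq cx => ->; rewrite ltnn.
    rewrite (negPf xc).
    have [xa|xa] := eqVneq x a; first by move: cNab cx xb; rewrite xa; lia.
    have xav : x != a :> nat by [].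
    have cav : c != a :> nat by [].
    by move: (sta x) (st c x); rewrite sc; lia.
  have [->|pa] := eqVneq p a; first by rewrite ltnn.
  move=> ps; have [->|_] := eqVneq x c.
    by move=> cx; have := st _ _ ps cx; rewrite sc => /(st _ _ ps); rewrite sb.
  by have [->//|_] := eqVneq x a; exact: st.
have sm' : n - #|porbits s'| <= m by rewrite cs'; lia.
have := IH s' sm' st'; rewrite /geodesic cs'.
suff -> : #|porbits (long_cycle n * s^-1)| = #|porbits (long_cycle n * s'^-1)|.+1.
  by rewrite addSnnS.
pose k := long_cycle n * s^-1.
rewrite -(porbitsV (_ * s'^-1)) invMg invgK es' -mulgA.
have -> : s * (long_cycle n)^-1 = k^-1 by rewrite invMg invgK.
rewrite card_porbits_join ?porbitsV // porbitV -porbitV.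
apply/negP => cin; suff /andP[/= h1 h2] : a <= c < b by rewrite h1 h2 in cNab.
(* the inverse of the complement k is s followed by the predecessor map *)
have sA z : z \in [pred z : 'I_n | a <= z < b] -> k^-1 z \in [pred z : 'I_n | a <= z < b].
  rewrite !inE invMg invgK permM => /andP[az zb].
  have sz : a < s z <= b.
    have [->|za] := eqVneq z a; first by rewrite sb ab leqnn.
    have zav : z != a :> nat by [].
    by have := sta z; lia.
  by rewrite val_long_cycleV; lia.
by apply: (@porbit_stable _ [pred z : 'I_n | a <= z < b] _ a c sA); rewrite ?inE ?leqnn.
Qed.

(** Everything below a geodesic point is again geodesic.  If two successive
    transpositions both cut cycles of s, they must therefore also both cut when
    applied to the long cycle; otherwise the triangle inequality would give
    three cycles to a permutation that has only one.  The inverses make the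
    transpositions act on the left. *)
Lemma geodesic_two_cuts (s : 'S_n) x1 y1 x2 y2 :
    0 < n -> geodesic s ->
    x1 != y1 -> x1 \in porbit s^-1 y1 ->
    x2 != y2 -> x2 \in porbit (tperm x1 y1 * s^-1) y2 ->
  x2 \in porbit (tperm x1 y1 * (long_cycle n)^-1) y2.
Proof.
move=> n0 /eqP gs n1 h1 n2 h2; apply: contraT => h.
have c1 := card_porbits_cut n1 h1; have c2 := card_porbits_cut n2 h2.
have l0 : #|porbits (long_cycle n)^-1| = 1%N by rewrite porbitsV card_porbits_long_cycle.
have l1 : x1 \in porbit (long_cycle n)^-1 y1.
  by rewrite porbitV porbit_long_cycle inE.
have l2 := card_porbits_cut n1 l1; have l3 := card_porbits_join h.
have := card_porbits_mul (long_cycle n * s^-1)^-1 (tperm x2 y2 * (tperm x1 y1 * s^-1)).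
rewrite porbitsV invMg invgK !mulgA mulgKV -!mulgA c2 c1 porbitsV card_ord.
by move: gs l0 l2 l3; card_lia.
Qed.

(** A geodesic permutation goes around each of its cycles in the cyclic order of
    the points.  If z came strictly between i and s i, the transpositions of i
    and s i and of z and s i would both cut s, whereas in the long cycle the
    second one joins the two cyclic intervals that the first one separates. *)
Lemma geodesic_next (s : 'S_n) i z : geodesic s -> z \in porbit s i ->
  (i < s i -> ~~ (i < z < s i)) /\ (s i < i -> s i <= z <= i).
Proof.
move=> gs zi; set j := s i; have n0 : 0 < n by apply: leq_ltn_trans (ltn_ord i).
have [eij|ij] := eqVneq i j; first by rewrite -eij ltnn.
have [->|zi'] := eqVneq z i; first by rewrite ltnn leqnn andbT; split=> // /ltnW.
have [->|zj] := eqVneq z j; first by rewrite ltnn leqnn andbF; split=> // /ltnW.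
have sj : s^-1 j = i by rewrite permK.
have tj : (tperm i j * s^-1) j = s^-1 i by rewrite permM tpermR.
(* cutting isolates i and leaves the rest of its cycle connected *)
have zin : z \in porbit (tperm i j * s^-1) j.
  suff : z \in [pred w | (w == i) || (w \in porbit (tperm i j * s^-1) j)].
    by rewrite inE (negPf zi').
  apply: (@porbit_stable _ _ s^-1 i); rewrite ?porbitV ?inE ?eqxx // => w.
  rewrite !inE => /orP[/eqP->|wj].
    by rewrite -tj porbit_step orbT.
  have [->|wi] := eqVneq w i.
    by rewrite -tj porbit_step orbT.
  have [->|wj'] := eqVneq w j; first by rewrite sj eqxx.
  have -> : s^-1 w = (tperm i j * s^-1) w by rewrite permM tpermD // eq_sym.
  by rewrite -(porbit_eqP _ _ _ wj) porbit_step orbT.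
have ii : i \in porbit s^-1 j by rewrite -{1}sj porbit_step.
have h := geodesic_two_cuts n0 gs ij ii zj zin.
have zvi : z != i :> nat by []. have zvj : z != j :> nat by [].
split=> [lij|lji].
  apply/negP => /andP[z1 z2]; rewrite porbit_sym in h.
  have := @porbit_stable _ [pred w : 'I_n | i <= w < j] _ z j _ _ h.
  rewrite !inE ltnn andbF => abs; suff : false by [].
  by apply: abs => [w|]; rewrite ?inE; [exact: interval_stable|lia].
have := @porbit_stable _ [pred w : 'I_n | j <= w < i] _ j z _ _ h.
rewrite !inE leqnn lji => abs.
have {abs} := abs _ isT; rewrite tpermC => abs.
have /andP[-> /ltnW//] : j <= z < i.
by apply: abs => w; rewrite !inE; exact: interval_stable.
Qed.
End Intervals.

Lemma porbits_partition (T : finType) (s : {perm T}) :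
  partition (porbits s) [set: T].
Proof.
apply/and3P; split.
- rewrite eqEsubset subsetT; apply/subsetP => x _; apply/bigcupP.
  by exists (porbit s x); rewrite ?imset_f ?porbit_id.
- apply/trivIsetP => _ _ /imsetP[x _ ->] /imsetP[y _ ->]; apply: contraNT.
  rewrite -setI_eq0 => /set0Pn[z /setIP[/porbit_eqP <- /porbit_eqP <-]] //.
- by apply/imsetP => -[x _ /setP/(_ x)]; rewrite inE porbit_id.
Qed.

Lemma pblock_porbits (T : finType) (s : {perm T}) x :
  pblock (porbits s) x = porbit s x.
Proof.
apply: def_pblock; rewrite ?porbit_id ?imset_f //.
exact: partition_trivIset (porbits_partition s).
Qed.

Section Biane.
Variable n : nat.
Hypothesis n_gt0 : 0 < n.
Implicit Types (i j z : 'I_n) (s : 'S_n).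
Local Open Scope group_scope.

(** If two different cycles crossed, the transpositions of a, c and of b, d would
    both cut s; but the first one separates b from d in the long cycle, so
    the second one joins there. *)
Lemma geodesic_noncrossing s a b c d : geodesic s ->
    a \in porbit s c -> b \in porbit s d -> a < b < c -> c < d ->
  porbit s c = porbit s d.
Proof.
move=> gs ac bd /andP[ab bc] cd; apply/porbit_eqP; apply: contraT => ncd.
have nac : a != c by apply: contraTneq (ltn_trans ab bc) => ->; rewrite ltnn.
have nbd : b != d by apply: contraTneq (ltn_trans bc cd) => ->; rewrite ltnn.
(* the cycle of b and d avoids a and c, so the first cut does not change it *)
have bd' : b \in porbit (tperm a c * s^-1) d.
  suff : b \in [pred w | (w \in porbit s d) && (w \in porbit (tperm a c * s^-1) d)].
    by rewrite inE => /andP[].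
  apply: (@porbit_stable _ _ s^-1 d); rewrite ?porbitV ?inE ?porbit_id // => w.
  rewrite !inE => /andP[wd wd'].
  have -> : s^-1 w = (tperm a c * s^-1) w.
    rewrite permM tpermD //; apply: contraNneq ncd => e.
      by move: ac wd; rewrite e porbit_sym => cw /porbit_eqP <-.
    by rewrite e.
  rewrite -(porbit_eqP _ _ _ wd') porbit_step andbT -(porbit_eqP _ _ _ wd).
  rewrite permM tpermD ?porbit_stepV //; apply: contraNneq ncd => e.
    by move: ac wd; rewrite e porbit_sym => cw /porbit_eqP <-.
  by rewrite e.
have ac' : a \in porbit s^-1 c by rewrite porbitV.
have h := geodesic_two_cuts n_gt0 gs nac ac' nbd bd'.
rewrite porbit_sym in h.
have := @porbit_stable _ [pred w : 'I_n | a <= w < c] _ b d _ _ h.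
rewrite !inE => abs; suff : a <= d < c by lia.
by apply: abs => [w|]; rewrite ?inE; [apply: interval_stable; lia|lia].
Qed.

Lemma geodesic_porbits_NC s : geodesic s -> porbits s \in NC n.
Proof.
move=> gs; rewrite !inE porbits_partition /=.
apply/forall_inP => A /imsetP[x _ ->]; apply/forall_inP => B /imsetP[y _ ->].
apply/implyP => /existsP[a /andP[aA /existsP[b /andP[bB /existsP[c /andP[cA /existsP[d]]]]]]].
move=> /andP[dB /and3P[ab bc cd]].
have e1 := porbit_eqP _ _ _ aA; have e2 := porbit_eqP _ _ _ bB.
have e3 := porbit_eqP _ _ _ cA; have e4 := porbit_eqP _ _ _ dB.
rewrite -e3 -e4; apply/eqP/(@geodesic_noncrossing s a b c d) => //.
- by rewrite e3.
- by rewrite e4.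
- by rewrite ab.
Qed.

Lemma block_perm_porbits s : geodesic s -> block_perm (porbits s) = s.
Proof.
move=> gs; apply/permP => i; rewrite block_permE ?porbits_partition //.
rewrite /block_succ pblock_porbits.
apply: next_enum_uniq; rewrite ?porbit_id ?porbit_step //.
- move=> e; apply/setP => z; rewrite inE; apply/idP/eqP => [|->]; last exact: porbit_id.
  move=> zi; have : z \in pred1 i; last by move/eqP.
  by apply: (@porbit_stable _ _ s i) => [w /eqP->| |//]; rewrite inE -?e.
- by move=> h z zi; have [] := geodesic_next gs zi => /(_ h).
- by move=> h z zi; have [_] := geodesic_next gs zi => /(_ h).
Qed.

Lemma porbits_block_perm (P : {set {set 'I_n}}) :
  partition P [set: 'I_n] -> porbits (block_perm P) = P.
Proof.
move=> pP; have /and3P[_ tP P0] := pP.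
have E i : porbit (block_perm P) i = pblock P i.
  have st z : z \in pblock P i -> block_perm P z \in pblock P i.
    move=> zi; rewrite block_permE // /block_succ (same_pblock tP zi).
    by rewrite -mem_enum mem_next mem_enum.
  have [_ ii] := pblock_partition i pP.
  apply/eqP; rewrite eqEsubset; apply/andP; split; apply/subsetP => z.
    by apply: porbit_stable.
  move=> zi; have fc : fcycle (block_perm P) (enum (pblock P i)).
    have := cycle_next (enum_uniq (pblock P i)).
    apply: (@sub_in_cycle _ (mem (pblock P i))) => [x y xi yi|].
      move=> /eqP <-; rewrite /= block_permE // /block_succ.
      by rewrite (same_pblock tP xi).
    by apply/allP => x; rewrite mem_enum.
  have := fconnect_cycle fc (_ : i \in _); rewrite mem_enum => /(_ ii z).
  rewrite mem_enum zi => /iter_findex <-; rewrite -permX; exact: mem_porbit.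
apply/setP => A; apply/imsetP/idP => [[i _ ->]|AP].
  by rewrite E; have [] := pblock_partition i pP.
have /set0Pn[i iA] : A != set0 by apply: contraNneq P0 => <-.
by exists i; rewrite // E (def_pblock tP AP iA).
Qed.

(** A block that meets the gap between two consecutive elements of another block
    cannot leave this gap without crossing that block. *)
Lemma NC_geodesic P : P \in NC n -> geodesic (block_perm P).
Proof.
rewrite inE => /andP[]; rewrite inE => pP /forall_inP ncP.
have /and3P[_ tP P0] := pP.
apply: climbs_stably_geodesic => // i z; rewrite !block_permE // /block_succ.
have [iP ii] := pblock_partition i pP; have [zP zz] := pblock_partition z pP.
have [ji hi] := next_enumP ii; have [jz _] := next_enumP zz.
set j := next _ i in ji hi *; set w := next _ z in jz *.
move=> ij /andP[iz zj].
have {hi} hi x : x \in pblock P i -> ~~ (i < x < j) by case: hi => [[_ h]|[/=]]; [exact: h|lia].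
have nzi : pblock P z != pblock P i.
  by apply: contraTneq zz => ->; apply/negP => /hi; rewrite iz zj.
have dis x : x \in pblock P z -> x \notin pblock P i.
  move=> xz; apply: contraNN nzi => xi.
  by rewrite -(same_pblock tP xz) -(same_pblock tP xi).
have crossing A B a b c d : A \in P -> B \in P -> a \in A -> c \in A -> b \in B ->
    d \in B -> a < b < c -> c < d -> A = B.
  move=> AP BP aA cA bB dB /andP[ab bc] cd; apply/eqP.
  apply: (implyP (forall_inP (ncP A AP) B BP)).
  apply/existsP; exists a; rewrite aA; apply/existsP; exists b; rewrite bB.
  apply/existsP; exists c; rewrite cA; apply/existsP; exists d.
  by rewrite dB ab bc cd.
have wi : w != i :> nat.
  by apply/negP => /eqP/val_inj e; have := dis w jz; rewrite e ii.
have wj : w != j :> nat.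
  by apply/negP => /eqP/val_inj e; have := dis w jz; rewrite e ji.
apply/andP; split; rewrite ltnNge; apply: contraNN nzi => h; apply/eqP.
  by apply: (crossing _ _ w i z j) => //; lia.
by apply/esym/(crossing _ _ i z j w) => //; lia.
Qed.

(** The correspondence of Biane: a geodesic permutation is determined by the
    noncrossing partition formed by its cycles. *)
Lemma sum_geodesic (V : nmodType) (F : 'S_n -> V) :
  (\sum_(s | geodesic s) F s = \sum_(P in NC n) F (block_perm P))%R.
Proof.
rewrite (reindex_onto (@block_perm n) (@porbits _)) /=; last first.
  by move=> s; exact: block_perm_porbits.
apply: eq_bigl => P; apply/andP/idP => [[gP /eqP <-]|PN].
  exact: geodesic_porbits_NC.
by rewrite NC_geodesic ?porbits_block_perm //; move: PN; rewrite inE => /andP[]; rewrite inE.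
Qed.

End Biane.

(** * Orbits of a pair of permutations and planar factorisations *)

Section PairOrbits.
Variable T : finType.
Implicit Types (s t r g : {perm T}) (x y z : T) (A : {set T}).
Local Open Scope group_scope.

Definition porbit2 s t x : {set T} := orbit 'P <<[set s; t]>> x.

Definition transitive2 s t : bool := [transitive <<[set s; t]>>, on [set: T] | 'P].

Definition stable s A := forall x, x \in A -> s x \in A.

Lemma porbit2_id s t x : x \in porbit2 s t x.
Proof. exact: orbit_refl. Qed.

Lemma porbit2_stable s t x : stable s (porbit2 s t x) /\ stable t (porbit2 s t x).
Proof.
split=> y /orbit_eqP e; rewrite /porbit2 -e.
  by apply: (mem_orbit 'P); apply: mem_gen; rewrite !inE eqxx.
by apply: (mem_orbit 'P); apply: mem_gen; rewrite !inE eqxx orbT.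
Qed.

Lemma stable_acts s A : stable s A -> s \in 'N(A | 'P).
Proof. by move=> sA; rewrite !inE; apply/subsetP => x /sA; rewrite inE. Qed.

Lemma porbit2_sub s t x A : stable s A -> stable t A -> x \in A ->
  porbit2 s t x \subset A.
Proof.
move=> /stable_acts sA /stable_acts tA xA; rewrite acts_sub_orbit //.
by rewrite gen_subG; apply/subsetP => y; rewrite !inE => /orP[]/eqP->; rewrite !inE in sA tA *.
Qed.

Lemma transitive2_porbit2 s t x : transitive2 s t = (porbit2 s t x == setT).
Proof.
apply/idP/eqP => [tr|e]; first by apply: (atransP tr); rewrite inE.
by rewrite /transitive2 -e; exact: atrans_orbit.
Qed.

(** A form of transitivity that is checked on the two generators and is easily
    transported along conjugations. *)
Lemma transitive2P s t x : reflect
  (forall A, A != set0 -> stable s A -> stable t A -> A = setT) (transitive2 s t).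
Proof.
apply: (iffP idP) => [tr A /set0Pn[y yA] sA tA|h].
  have /eqP e : porbit2 s t y == setT by rewrite -transitive2_porbit2.
  by apply/eqP; rewrite eqEsubset subsetT /= -e porbit2_sub.
have [h1 h2] := porbit2_stable s t x.
rewrite (transitive2_porbit2 _ _ x); apply/eqP/h => //.
by apply/set0Pn; exists x; exact: porbit2_id.
Qed.

Lemma stable_bij s A x : stable s A -> (s x \in A) = (x \in A).
Proof. by move=> /stable_acts/astabsP/(_ x). Qed.

(** Replacing t by the product ts does not change the generated group.  This
    passes between pairs (s, t) and factorisations of r = ts. *)
Lemma transitive2_mul s t : transitive2 s (t * s) = transitive2 s t.
Proof.
case: (pickP T) => [x _|T0]; last first.
  have F s' t' : transitive2 s' t' = false.
    by apply/negP => /imsetP[x]; have := T0 x.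
  by rewrite !F.
apply/(transitive2P _ _ x)/(transitive2P _ _ x) => h A A0 sA tA; apply: h => // y yA.
  by rewrite permM; apply: sA; apply: tA.
by rewrite -(stable_bij _ sA) -permM; exact: tA.
Qed.

Lemma porbits1_transitive2 s t : #|porbits t| = 1%N -> transitive2 s t.
Proof.
move=> /eqP/cards1P[A eA].
have /set0Pn[_ /imsetP[x _ _]] : porbits t != set0 by rewrite -card_gt0 eA cards1.
have cA z : porbit t z = A by apply/eqP; rewrite -in_set1 -eA imset_f.
apply/(transitive2P _ _ x) => B /set0Pn[y yB] _ tB; apply/setP => z; rewrite inE.
apply: (@porbit_stable _ (mem B) _ y z tB yB).
by rewrite cA -(cA z) porbit_id.
Qed.

Lemma porbitJ s g x : porbit (s ^ g) (g x) = g @: porbit s x.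
Proof.
have h k : g (iter k s x) = iter k (s ^ g) (g x).
  by elim: k => //= m <-; rewrite permJ.
apply/setP => y; apply/porbitP/imsetP => [[i ->]|[z /porbitP[i ->] ->]].
  by exists ((s ^+ i) x); rewrite ?mem_porbit // !permX h.
by exists i; rewrite !permX h.
Qed.

Lemma porbitsJ s g : porbits (s ^ g) = [set g @: A | A : {set T} in porbits s].
Proof.
apply/setP => A; apply/imsetP/imsetP => [[x _ ->]|[_ /imsetP[x _ ->] ->]].
  by exists (porbit s (g^-1 x)); rewrite ?imset_f // -porbitJ permKV.
by exists (g x); rewrite // porbitJ.
Qed.

Lemma card_porbitsJ s g : #|porbits (s ^ g)| = #|porbits s|.
Proof. by rewrite porbitsJ card_imset //; apply: imset_inj; exact: perm_inj. Qed.

Lemma mult_ext_permJ (R : comNzRingType) (u : nat -> R) s g :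
  mult_ext_perm u (s ^ g) = mult_ext_perm u s.
Proof.
rewrite /mult_ext_perm /mult_ext porbitsJ big_imset /=; last first.
  by move=> A B _ _; apply: imset_inj; exact: perm_inj.
by apply: eq_bigr => A _; rewrite card_imset //; exact: perm_inj.
Qed.

Lemma transitive2J s t g : transitive2 (s ^ g) (t ^ g) = transitive2 s t.
Proof.
have imp s' t' g' : transitive2 s' t' -> transitive2 (s' ^ g') (t' ^ g').
  case: (pickP T) => [x _|T0].
    move=> /(transitive2P _ _ x) h; apply/(transitive2P _ _ x) => A A0 sA tA.
    suff e : g' @^-1: A = setT.
      by apply/setP => y; have /setP/(_ (g'^-1 y)) := e; rewrite !inE permKV.
    apply: h.
    - case/set0Pn: A0 => y yA; apply/set0Pn; exists (g'^-1 y).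
      by rewrite inE permKV.
    - by move=> y; rewrite !inE -permJ => /sA.
    - by move=> y; rewrite !inE -permJ => /tA.
  by move=> /imsetP[x]; have := T0 x.
apply/idP/idP => [/(imp _ _ g^-1)|]; last exact: imp.
by rewrite !conjgK.
Qed.

Lemma card_porbits_transitive2 s t : transitive2 s t ->
  #|porbits s| + #|porbits t| + #|porbits (t * s)| <= #|T| + 2.
Proof.
move=> tr; have [c [cs ct]] := coloured_genus_bound s t.
suff : #|c @: T| <= 1 by card_lia.
case/imsetP: (tr) => x _ _.
suff cc z : c z = c x.
  rewrite (_ : c @: T = [set c x]) ?cards1 //; apply/setP => A; rewrite inE.
  by apply/imsetP/eqP => [[z _ ->]|->]; [rewrite cc|exists x].
have /transitive2P-/(_ x [set w | c w == c x]) e := tr.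
have : z \in [set: T] by [].
rewrite -e ?inE => [/eqP//||w|w]; rewrite ?inE.
- by apply/set0Pn; exists x; rewrite inE.
- by rewrite cs.
- by rewrite ct.
Qed.

End PairOrbits.

Section PlanarSums.
Variables (R : numFieldType) (u v : nat -> R).
Local Open Scope ring_scope.

(** For j = n + 1 and r an n-cycle, or j = n and r with two cycles, the
    factorisations r = ts that occur here are the planar ones: the genus bound
    is an equality. *)
Definition planar_sum (T : finType) (j : nat) (r : {perm T}) : R :=
  \sum_(s : {perm T} | transitive2 s r &&
      (#|porbits s| + #|porbits (r * s^-1)%g| == j)%N)
    mult_ext_perm u s * mult_ext_perm v (r * s^-1)%g.

Lemma planar_sumJ (T : finType) j (r g : {perm T}) :
  planar_sum j (r ^ g)%g = planar_sum j r.
Proof.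
rewrite /planar_sum (reindex_inj (@conjg_inj _ g)) /=.
apply: eq_big => s; rewrite -conjVg -conjMg.
  by rewrite transitive2J !card_porbitsJ.
by rewrite !mult_ext_permJ.
Qed.

(** Sorting the transitive pairs by their product. *)
Lemma sum_transitive2 (T : finType) j :
  \sum_(st : {perm T} * {perm T} | transitive2 st.1 st.2 &&
      (#|porbits st.1| + #|porbits st.2| == j)%N)
    mult_ext_perm u st.1 * mult_ext_perm v st.2 =
  \sum_(r : {perm T}) planar_sum j r.
Proof.
rewrite -(pair_big_dep xpredT
  (fun s t : {perm T} => transitive2 s t && (#|porbits s| + #|porbits t| == j)%N)
  (fun s t : {perm T} => mult_ext_perm u s * mult_ext_perm v t)) /=.
rewrite /planar_sum [RHS](exchange_big_dep xpredT) //=; apply: eq_bigr => s _.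
rewrite (reindex_inj (mulIg s^-1)%g) /=; apply: eq_bigl => r.
by rewrite -transitive2_mul mulgKV.
Qed.

(** Transitive pairs with many cycles have a product with few cycles. *)
Lemma planar_sum_eq0 (T : finType) j (r : {perm T}) :
  (#|T| + 2 < j + #|porbits r|)%N -> planar_sum j r = 0.
Proof.
move=> jr; apply: big_pred0 => s; apply/negP => /andP[tr /eqP ej].
have tr' : transitive2 s (r * s^-1)%g by rewrite -transitive2_mul mulgKV.
by have := card_porbits_transitive2 tr'; rewrite mulgKV; move: ej jr; card_lia.
Qed.

End PlanarSums.

(** * Summing over permutations with one or two cycles *)

Section Orbits.
Variable T : finType.
Implicit Types (r g c : {perm T}) (x y z : T).
Local Open Scope group_scope.

Lemma porbit_expg_inj r x i j : i < #|porbit r x| -> j < #|porbit r x| ->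
  (r ^+ i) x = (r ^+ j) x -> i = j.
Proof.
move=> hi hj; rewrite !permX -(nth_traject r hi) -(nth_traject r hj) => /eqP.
by rewrite nth_uniq ?size_traject ?uniq_traject_porbit // => /eqP.
Qed.

Lemma porbit_modn r x i : (r ^+ (i %% #|porbit r x|)) x = (r ^+ i) x.
Proof.
rewrite {2}(divn_eq i #|porbit r x|) addnC expgD permM.
suff -> : forall y, y \in porbit r x -> (r ^+ (i %/ #|porbit r x| * #|porbit r x|)) y = y.
  by [].
  exact: mem_porbit.
move=> y yx; have e : #|porbit r x| = #|porbit r y| by rewrite (porbit_eqP _ _ _ yx).
have it : (r ^+ #|porbit r x|) y = y by rewrite permX e iter_porbit.
elim: (i %/ _) => [|k IH]; first by rewrite mul0n perm1.
by rewrite mulSn expgD permM it.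
Qed.

Lemma conj_eqP c g r : reflect (forall x, r (g x) = g (c x)) (c ^ g == r).
Proof.
apply: (iffP eqP) => [<- x|h]; first by rewrite permJ.
by apply/permP => x; rewrite -(permKV g x) permJ h.
Qed.

Lemma conj_expg c g r i x : c ^ g = r -> (r ^+ i) (g x) = g ((c ^+ i) x).
Proof. by move=> <-; rewrite -conjXg permJ. Qed.

(** Averaging a class function over a conjugacy class without computing
    centralisers: both sides sum G (c ^ g) over all g. *)
Lemma sum_conj_count (R : comNzRingType) (c : {perm T}) (G : {perm T} -> R) :
  (forall r g, G (r ^ g)%g = G r) ->
  (\sum_r G r * #|[set g | (c ^ g)%g == r]|%:R = #|T|`!%:R * G c)%R.
Proof.
move=> GJ; transitivity (\sum_(g : {perm T}) G ((c ^ g)%g))%R; last first.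
  rewrite (eq_bigr (fun=> G c)) // sumr_const -[LHS]mulr_natl; congr (_%:R * _)%R.
  by rewrite -[in RHS]cardsT -card_perm; apply: eq_card => s; apply/esym/subsetP.
rewrite [RHS](partition_big (fun g => (c ^ g)%g) xpredT) //=; apply: eq_bigr => r _.
rewrite (eq_bigr (fun=> G r)) => [|g /eqP->//].
by rewrite sumr_const mulr_natr; congr (_ *+ _)%R; apply: eq_card => g; rewrite !inE.
Qed.

End Orbits.

Section Cycles.
Local Open Scope group_scope.

Lemma long_cycle_expg n (i j : 'I_n) : i = 0 :> nat -> (long_cycle n ^+ j) i = j.
Proof.
move=> i0; apply: ord_inj; case: j => j /=.
elim: j => [|j IH] jn; first by rewrite perm1.
by rewrite expgSr permM val_long_cycle IH ?modn_small // ltnW.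
Qed.

(** A conjugation of the long cycle to r is determined by the image of 0, which
    can be any point. *)
Lemma card_conj_long_cycle n (r : 'S_n) : #|porbits r| = 1%N ->
  #|[set g | long_cycle n ^ g == r]| = n.
Proof.
move=> r1; have n0 : 0 < n by rewrite -r1 -[X in _ <= X]card_ord leq_imset_card.
pose z : 'I_n := Ordinal n0.
have rT x : porbit r x = setT.
  apply: (transitive2P _ _ x (porbits1_transitive2 1 r1)).
  - by apply/set0Pn; exists x; rewrite porbit_id.
  - by move=> y; rewrite perm1.
  - by move=> y /porbit_eqP <-; exact: porbit_step.
have cn x : #|porbit r x| = n by rewrite rT cardsT card_ord.
rewrite -(@card_in_imset _ _ (fun g : 'S_n => g z)); last first.
  move=> g g'; rewrite !inE => /eqP h /eqP h' e; apply/permP => i.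
  by rewrite -(@long_cycle_expg n z i) // -!(conj_expg _ _ h, conj_expg _ _ h') e.
rewrite -[RHS]card_ord -cardsT; apply: eq_card => x; rewrite inE; apply/imsetP.
(* the conjugation that sends 0 to x *)
pose f (i : 'I_n) := (r ^+ i) x.
have f_inj : injective f.
  by move=> i j /porbit_expg_inj e; apply/ord_inj/e; rewrite cn.
exists (perm f_inj); last by rewrite permE /f perm1.
rewrite inE; apply/conj_eqP => i; rewrite !permE /f /=.
by rewrite -[X in _ %% X](cn x) porbit_modn expgSr permM.
Qed.

Lemma two_cycles_lshift t s (i : 'I_t) : two_cycles t s (lshift s i) = lshift s (ordS i).
Proof. by rewrite permE /two_cycles_fun (unsplitK (inl _ i)). Qed.

Lemma two_cycles_rshift t s (i : 'I_s) : two_cycles t s (rshift t i) = rshift t (ordS i).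
Proof. by rewrite permE /two_cycles_fun (unsplitK (inr _ i)). Qed.

Lemma two_cycles_expg_lshift t s (i j : 'I_t) : i = 0 :> nat ->
  (two_cycles t s ^+ j) (lshift s i) = lshift s j.
Proof.
move=> i0; have h k : (two_cycles t s ^+ k) (lshift s i) = lshift s ((long_cycle t ^+ k) i).
  elim: k => [|k IH]; first by rewrite !perm1.
  by rewrite !expgSr !permM IH two_cycles_lshift permE.
by rewrite h long_cycle_expg.
Qed.

Lemma two_cycles_expg_rshift t s (i j : 'I_s) : i = 0 :> nat ->
  (two_cycles t s ^+ j) (rshift t i) = rshift t j.
Proof.
move=> i0; have h k : (two_cycles t s ^+ k) (rshift t i) = rshift t ((long_cycle s ^+ k) i).
  elim: k => [|k IH]; first by rewrite !perm1.
  by rewrite !expgSr !permM IH two_cycles_rshift permE.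
by rewrite h long_cycle_expg.
Qed.

Lemma porbit_two_cycles_l t s (i : 'I_t) : i = 0 :> nat ->
  porbit (two_cycles t s) (lshift s i) = [set lshift s j | j : 'I_t].
Proof.
move=> i0; apply/setP => y; apply/idP/imsetP => [yi|[j _ ->]].
  suff : y \in [set lshift s j | j : 'I_t] by move/imsetP.
  apply: (@porbit_stable _ (mem [set lshift s j | j : 'I_t]) _ _ _ _ _ yi).
    move=> _ /imsetP[j _ ->]; rewrite two_cycles_lshift; exact: imset_f.
  exact: imset_f.
by rewrite -(two_cycles_expg_lshift s j i0) mem_porbit.
Qed.

Lemma porbit_two_cycles_r t s (i : 'I_s) : i = 0 :> nat ->
  porbit (two_cycles t s) (rshift t i) = [set rshift t j | j : 'I_s].
Proof.
move=> i0; apply/setP => y; apply/idP/imsetP => [yi|[j _ ->]].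
  suff : y \in [set rshift t j | j : 'I_s] by move/imsetP.
  apply: (@porbit_stable _ (mem [set rshift t j | j : 'I_s]) _ _ _ _ _ yi).
    move=> _ /imsetP[j _ ->]; rewrite two_cycles_rshift; exact: imset_f.
  exact: imset_f.
by rewrite -(two_cycles_expg_rshift t j i0) mem_porbit.
Qed.

(** The possible images of the first points of the two cycles under a
    conjugation of [two_cycles t s] to r. *)
Definition separate_pairs (T : finType) (r : {perm T}) t s : {set T * T} :=
  [set xy | [&& xy.2 \notin porbit r xy.1, #|porbit r xy.1| == t & #|porbit r xy.2| == s]].

(** A conjugation is determined by the images of the first points of the two
    cycles, since it intertwines the powers of the two permutations. *)
Lemma card_conj_two_cycles t s (r : 'S_(t + s)) : 0 < t -> 0 < s ->
  #|[set g | two_cycles t s ^ g == r]| = #|separate_pairs r t s|.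
Proof.
move=> t0 s0; pose a : 'I_t := Ordinal t0; pose b : 'I_s := Ordinal s0.
rewrite -(@card_in_imset _ _ (fun g : 'S_(t + s) => (g (lshift s a), g (rshift t b)))); last first.
  move=> g g'; rewrite !inE => /eqP h /eqP h' [ea eb]; apply/permP => i.
  rewrite -(splitK i); case: (fintype.split i) => j /=.
    rewrite -(@two_cycles_expg_lshift t s a j) //.
    by rewrite -!(conj_expg _ _ h, conj_expg _ _ h') ea.
  rewrite -(@two_cycles_expg_rshift t s b j) //.
  by rewrite -!(conj_expg _ _ h, conj_expg _ _ h') eb.
apply: eq_card => -[x y]; rewrite inE /=; apply/imsetP/and3P.
  move=> [g]; rewrite inE => /eqP <- [-> ->]; rewrite !porbitJ.
  rewrite mem_imset; last exact: perm_inj.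
  rewrite !(card_imset _ (@perm_inj _ g)) porbit_two_cycles_l // porbit_two_cycles_r //.
  rewrite !card_imset ?card_ord ?eqxx; [|exact: rshift_inj|exact: lshift_inj].
  split=> //; apply/imsetP => -[j _] /eqP; by rewrite eq_rlshift.
move=> [yx /eqP xt /eqP ys].
(* the conjugation that sends the two first points to x and y *)
pose f (i : 'I_(t + s)) := match fintype.split i with
  | inl j => (r ^+ j) x | inr j => (r ^+ j) y end.
have fl j : f (lshift s j) = (r ^+ j) x by rewrite /f (unsplitK (inl _ j)).
have fr j : f (rshift t j) = (r ^+ j) y by rewrite /f (unsplitK (inr _ j)).
have dis i j : (r ^+ i) x = (r ^+ j) y -> False.
  move=> e; move/negP: yx; apply; apply/porbit_eqP.
  by rewrite -(porbit_perm r j y) -e porbit_perm.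
have f_inj : injective f.
  move=> i j; rewrite -(splitK i) -(splitK j).
  case: (fintype.split i) => i'; case: (fintype.split j) => j' /=; rewrite ?fl ?fr.
  - by move/porbit_expg_inj => e; congr lshift; apply/ord_inj/e; rewrite xt.
  - by move/dis.
  - by move/esym/dis.
  - by move/porbit_expg_inj => e; congr rshift; apply/ord_inj/e; rewrite ys.
exists (perm f_inj); last by rewrite !permE fl fr !perm1.
rewrite inE; apply/conj_eqP => i; rewrite -(splitK i).
case: (fintype.split i) => j /=; rewrite !permE -?[two_cycles_fun _](permE (@two_cycles_inj t s)).
  rewrite [perm _ _]two_cycles_lshift !fl /=.
  by rewrite -[X in _ %% X]xt porbit_modn expgSr permM.
rewrite [perm _ _]two_cycles_rshift !fr /=.
by rewrite -[X in _ %% X]ys porbit_modn expgSr permM.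
Qed.
End Cycles.

Section SumOverOrbits.
Variable R : numFieldType.
Local Open Scope ring_scope.

(** Giving every point the weight 1/(length of its cycle) counts cycles. *)
Lemma sum_inv_porbit (T : finType) (r : {perm T}) (A : {set {set T}}) :
  A \subset porbits r -> \sum_(x in cover A) #|porbit r x|%:R^-1 = #|A|%:R :> R.
Proof.
move=> sA; rewrite big_trivIset; last exact: trivIsetS sA (partition_trivIset (porbits_partition r)).
rewrite -sumr_const; apply: eq_bigr => B /(subsetP sA)/imsetP[x _ ->].
rewrite (eq_bigr (fun=> #|porbit r x|%:R^-1)) => [|y /porbit_eqP->//].
by rewrite sumr_const -[LHS]mulr_natr mulVf // pnatr_eq0 card_porbit_neq0.
Qed.

(** With weight 1/(2 |x| |y|) on a pair of points in different cycles of a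
    permutation with two cycles, each of the two orders of the cycles
    contributes one half. *)
Lemma sum_separate_pairs n (r : 'S_n) : #|porbits r| = 2%N ->
  \sum_(1 <= t < n) #|separate_pairs r t (n - t)%N|%:R / (2 * t%:R * (n - t)%N%:R) = 1 :> R.
Proof.
move=> r2.
have cT : cover (porbits r) = setT := cover_partition (porbits_partition r).
have tr := partition_trivIset (porbits_partition r).
have other x : \sum_(y | y \notin porbit r x) #|porbit r y|%:R^-1 = 1 :> R.
  have xr : porbit r x \in porbits r by exact: imset_f.
  have k1 : #|porbits r :\ porbit r x| = 1%N.
    by move: r2; rewrite (cardsD1 (porbit r x)) xr => -[].
  transitivity (#|porbits r :\ porbit r x|%:R : R); last by rewrite k1.
  rewrite -(@sum_inv_porbit _ r) ?subD1set // coverD1 // cT; apply: eq_bigl => y.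
  by rewrite !inE andbT.
have cards x y : y \notin porbit r x -> (#|porbit r x| + #|porbit r y|)%N = n.
  move=> yx; have := card_partition (porbits_partition r).
  rewrite cardsT card_ord => en; apply: etrans (esym en).
  have xy : porbit r x != porbit r y by apply: contraNneq yx => ->; exact: porbit_id.
  rewrite (bigD1 (porbit r x)) ?imset_f //= (bigD1 (porbit r y)) ?imset_f 1?eq_sym //=.
  rewrite big1 ?addn0 // => A /andP[/andP[Ar nx] ny]; exfalso.
  have : [set porbit r x; porbit r y; A] \subset porbits r.
    by apply/subsetP => B; rewrite !inE => /orP[/orP[]|] /eqP->; rewrite ?imset_f.
  move/subset_leq_card; rewrite r2 -setUA cardsU1 cards2 !inE negb_or xy.
  by rewrite [_ == A]eq_sym nx [_ == A]eq_sym ny.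
transitivity (\sum_(xy : 'I_n * 'I_n | xy.2 \notin porbit r xy.1)
    (2 * #|porbit r xy.1|%:R * #|porbit r xy.2|%:R)^-1 : R); last first.
  rewrite -(pair_big_dep xpredT (fun x y => y \notin porbit r x)
    (fun x y => (2 * #|porbit r x|%:R * #|porbit r y|%:R)^-1 : R)) /=.
  under eq_bigr => x _.
    under eq_bigr => y _ do rewrite invfM.
    rewrite -mulr_sumr other mulr1 invfM; over.
  rewrite -mulr_sumr (eq_bigl (fun x => x \in cover (porbits r))); last first.
    by move=> x; rewrite cT inE.
  by rewrite sum_inv_porbit // r2 mulVf // pnatr_eq0.
pose F (xy : 'I_n * 'I_n) : R := (2 * #|porbit r xy.1|%:R * #|porbit r xy.2|%:R)^-1.
transitivity (\sum_(1 <= t < n) \sum_(xy | xy.2 \notin porbit r xy.1)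
    (if t == #|porbit r xy.1| then F xy else 0)).
  apply: eq_big_nat => t /andP[t1 tn].
  rewrite -big_mkcondr mulr_natl -sumr_const; apply: eq_big => [[x y]|[x y]]; rewrite inE /=.
    apply: andb_id2l => yx; have e := cards x y yx; rewrite eq_sym.
    by case: eqP => //= et; apply/eqP; move: e et; card_lia.
  by move=> /and3P[_ /eqP<- /eqP<-].
rewrite exchange_big /=; apply: eq_bigr => -[x y] /= yx.
have e := cards x y yx.
have x0 : (0 < #|porbit r x|)%N by rewrite lt0n card_porbit_neq0.
have y0 : (0 < #|porbit r y|)%N by rewrite lt0n card_porbit_neq0.
rewrite (bigD1_seq #|porbit r x|) ?iota_uniq ?mem_index_iota ?x0 //=; last first.
  by move: e y0; card_lia.
by rewrite eqxx big1 ?addr0 // => t /negPf->.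
Qed.

End SumOverOrbits.

Section PlanarSumsByType.
Variables (R : numFieldType) (u v : nat -> R) (n : nat).
Hypothesis n_gt0 : (0 < n)%N.
Local Open Scope ring_scope.

Lemma sum_planar_long_cycle :
  \sum_(r : 'S_n) planar_sum u v n.+1 r = n.-1`!%:R * planar_sum u v n.+1 (long_cycle n).
Proof.
have n0 : n%:R != 0 :> R by rewrite pnatr_eq0 -lt0n.
have := sum_conj_count (long_cycle n) (@planar_sumJ R u v 'I_n n.+1).
have fe : n`! = (n * n.-1`!)%N by rewrite -{1}(prednK n_gt0) factS prednK.
rewrite card_ord fe natrM -mulrA.
rewrite (eq_bigr (fun r => n%:R * planar_sum u v n.+1 r)) => [|r _].
  by rewrite -mulr_sumr => /(mulfI n0).
rewrite mulrC; have [r1|r1] := eqVneq #|porbits r| 1%N; first by rewrite card_conj_long_cycle.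
rewrite planar_sum_eq0 ?mulr0 // card_ord.
suff : (0 < #|porbits r|)%N by lia.
by apply/card_gt0P; exists (porbit r (Ordinal n_gt0)); rewrite imset_f.
Qed.

Lemma sum_planar_two_cycles_type t s : (0 < t)%N -> (0 < s)%N -> (n = t + s)%N ->
  \sum_(r : 'S_n) planar_sum u v n r * #|separate_pairs r t s|%:R =
  n`!%:R * planar_sum u v (t + s)%N (two_cycles t s).
Proof.
move=> t0 s0; move: n => m em; rewrite {}em.
have := sum_conj_count (two_cycles t s) (@planar_sumJ R u v 'I_(t + s) (t + s)%N).
rewrite card_ord => <-; apply: eq_bigr => r _.
by rewrite card_conj_two_cycles.
Qed.

(** More than two cycles are excluded by the genus bound, and a single cycle by
    the sign of the permutations. *)
Lemma planar_sum_n_eq0 (r : 'S_n) : #|porbits r| != 2%N -> planar_sum u v n r = 0.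
Proof.
move=> r2; have [lt2|] := ltnP 2 #|porbits r|.
  by apply: planar_sum_eq0; rewrite card_ord ltn_add2l.
rewrite leq_eqVlt (negPf r2) /= ltnS => le1.
apply: big_pred0 => s; apply/negP => /andP[_ /eqP es].
have r1 : #|porbits r| = 1%N.
  apply/eqP; rewrite eqn_leq le1.
  by apply/card_gt0P; exists (porbit r (Ordinal n_gt0)); rewrite imset_f.
have eo : odd n = odd #|porbits s| (+) odd #|porbits (r * s^-1)%g| by rewrite -oddD es.
have := odd_permM (r * s^-1)%g s; rewrite mulgKV /odd_perm r1 card_ord eo.
by case: (odd _); case: (odd _).
Qed.

(** The factor 1/2 and the sum over ordered pairs (t, n - t) compensate: for each
    permutation with two cycles, the weights of [sum_separate_pairs] over all t
    add up to 1. *)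
Lemma sum_planar_two_cycles :
  \sum_(r : 'S_n) planar_sum u v n r =
  n`!%:R / 2 * \sum_(1 <= t < n)
    planar_sum u v (t + (n - t))%N (two_cycles t (n - t)%N) / (t%:R * (n - t)%N%:R).
Proof.
transitivity (\sum_(r : 'S_n) \sum_(1 <= t < n) planar_sum u v n r *
    (#|separate_pairs r t (n - t)%N|%:R / (2 * t%:R * (n - t)%N%:R))).
  apply: eq_bigr => r _; rewrite -mulr_sumr.
  have [r2|r2] := eqVneq #|porbits r| 2%N; first by rewrite sum_separate_pairs ?mulr1.
  by rewrite planar_sum_n_eq0 // mul0r.
rewrite exchange_big mulr_sumr; apply: eq_big_nat => t /andP[t0 tn].
have s0 : (0 < n - t)%N by rewrite subn_gt0.
have := sum_planar_two_cycles_type t0 s0 (esym (subnKC (ltnW tn))).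
under eq_bigr => r _ do rewrite mulrA.
rewrite -mulr_suml => ->.
have tR : t%:R != 0 :> R by rewrite pnatr_eq0 -lt0n.
have sR : (n - t)%N%:R != 0 :> R by rewrite pnatr_eq0 -lt0n.

by field; rewrite tR sR.
Qed.

End PlanarSumsByType.

(** * The exponential formula for one and for two permutations *)

Section Agreement.
Variable T : finType.
Implicit Types (s t : {perm T}) (x y z : T) (A B C : {set T}).
Local Open Scope group_scope.

(** Cycles through a stable set depend only on the permutation inside that set;
    this is what makes the weights below multiplicative. *)
Lemma porbit_agree A s s' x : stable s A -> {in A, s =1 s'} -> x \in A ->
  porbit s x = porbit s' x.
Proof.
have sub (r r' : {perm T}) : stable r A -> {in A, r =1 r'} -> x \in A -> porbit r x \subset porbit r' x.
  move=> rA e xA; apply/subsetP => y yx.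
  suff : y \in [pred w | (w \in A) && (w \in porbit r' x)] by rewrite inE => /andP[].
  apply: (porbit_stable _ _ yx); rewrite ?inE ?xA ?porbit_id // => w.
  rewrite !inE => /andP[wA /porbit_eqP <-]; rewrite rA // e //; exact: porbit_step.
move=> sA e xA; apply/eqP; rewrite eqEsubset !sub // => [y yA|y yA]; rewrite -?e //.
exact: sA.
Qed.

Lemma porbit2_agree A s s' t t' x : stable s A -> stable t A ->
    {in A, s =1 s'} -> {in A, t =1 t'} -> x \in A ->
  porbit2 s t x = porbit2 s' t' x.
Proof.
have sub (r r' q q' : {perm T}) : stable r A -> stable q A -> {in A, r =1 r'} -> {in A, q =1 q'} ->
    x \in A -> porbit2 r q x \subset porbit2 r' q' x.
  move=> rA qA er eq xA; have [h1 h2] := porbit2_stable r' q' x.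
  apply: (@subset_trans _ _ (mem (A :&: porbit2 r' q' x))); last exact: subsetIr.
  apply: porbit2_sub; rewrite ?inE ?xA ?porbit2_id // => w; rewrite !inE => /andP[wA w2].
    by rewrite rA // er // h1.
  by rewrite qA // eq // h2.
move=> sA tA es et xA; apply/eqP; rewrite eqEsubset !sub //.
all: by move=> y yA; rewrite -?es -?et // ?sA ?tA.
Qed.

Lemma perm_on_stable A s : perm_on A s -> stable s A.
Proof. by move=> sA x xA; rewrite perm_closed. Qed.

End Agreement.

Section Weights.
Variables (R : comNzRingType) (T : finType).
Implicit Types (s t : {perm T}) (x y z : T) (A B C : {set T}) (a b : nat -> R).
Local Open Scope ring_scope.

(** Only the cycles meeting A count, so that fixed points outside A have no
    weight.  This allows permutations of subsets to be treated as permutations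
    of the whole type supported in the subset. *)
Definition cycle_weight a A s : R := \prod_(C in porbit s @: A) a #|C|.

Definition perm_sum a A : R := \sum_(s | perm_on A s) cycle_weight a A s.

(** The connected part of a product of two sums over permutations: the pairs for
    which all of A is one orbit, namely that of the point x of A. *)
Definition conn_sum a b x A : R :=
  \sum_(s | perm_on A s) \sum_(t | perm_on A t && (porbit2 s t x == A))
    cycle_weight a A s * cycle_weight b A t.

Lemma cycle_weight_agree a A s s' : stable s A -> {in A, s =1 s'} ->
  cycle_weight a A s = cycle_weight a A s'.
Proof.
move=> sA e; rewrite /cycle_weight (_ : porbit s @: A = porbit s' @: A) //.
by apply: eq_in_imset => x xA; exact: porbit_agree e xA.
Qed.

Lemma cycle_weight_split a A B s : stable s A -> stable s B -> [disjoint A & B] ->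
  cycle_weight a (A :|: B) s = cycle_weight a A s * cycle_weight a B s.
Proof.
move=> sA sB AB; rewrite /cycle_weight imsetU -bigU /=.
  by apply: eq_bigl => C; rewrite !inE.
rewrite -setI_eq0; apply: contraTT AB => /set0Pn[_ /setIP[/imsetP[x xA ->] /imsetP[y yB]]].
move=> e; rewrite -setI_eq0; apply/set0Pn; exists x; rewrite inE xA /=.
by apply: (@porbit_stable _ (mem B) s y x sB yB); rewrite -e porbit_id.
Qed.

(** A permutation supported in B and preserving C is the product of a
    permutation supported in C and one supported in the rest of B. *)
Lemma sum_stable_split (V : nmodType) (F : {perm T} -> V) B C : C \subset B ->
  \sum_(s | perm_on B s && (C \subset s @^-1: C)) F s =
  \sum_(s | perm_on C s) \sum_(t | perm_on (B :\: C) t) F (s * t)%g.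
Proof.
move=> CB; set D := B :\: C.
have dCD : [disjoint C & D] by rewrite -setI_eq0 /D setDE setICA setICr setI0.
have dDC : [disjoint D & C] by rewrite disjoint_sym.
rewrite pair_big /=.
rewrite (reindex_onto (fun st : {perm T} * {perm T} => (st.1 * st.2)%g)
  (fun s => (restr_perm C s, restr_perm D s))) /=; last first.
  move=> s /andP[sB /subsetP sC].
  have nC : s \in 'N(C | 'P)%g by apply: stable_acts => y /sC; rewrite inE.
  have nD : s \in 'N(D | 'P)%g.
    apply: stable_acts => y; rewrite !inE (perm_closed _ sB) => /andP[yC ->].
    by rewrite andbT; have /astabsP/(_ y) /= -> := nC.
  apply/permP => y; rewrite permM.
  have [yC|yC] := boolP (y \in C).
    rewrite (restr_permE nC yC) (out_perm (restr_perm_on D s)) //.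
    by rewrite !inE negb_and negbK; have /astabsP/(_ y) /= -> := nC; rewrite yC.
  rewrite (out_perm (restr_perm_on C s) yC).
  have [yD|yD] := boolP (y \in D); first by rewrite (restr_permE nD yD).
  rewrite (out_perm (restr_perm_on D s) yD) (out_perm sB) //.
  by move: yD; rewrite inE yC.
apply: eq_bigl => -[s t] /=; apply/andP/andP => [[_ /eqP[<- <-]]|[sC tD]].
  by rewrite !restr_perm_on.
have stC y : y \in C -> (s * t)%g y = s y.
  move=> yC; rewrite permM (out_perm tD) // !inE negb_and negbK.
  by rewrite perm_closed ?yC.
have stD y : y \in D -> (s * t)%g y = t y.
  move=> yD; rewrite permM (out_perm sC) //; by move: yD; rewrite inE => /andP[].
have nC : (s * t)%g \in 'N(C | 'P)%g.
  by apply: stable_acts => y yC; rewrite stC // perm_closed.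
have nD : (s * t)%g \in 'N(D | 'P)%g.
  by apply: stable_acts => y yD; rewrite stD // perm_closed.
split.
  apply/andP; split; last by apply/subsetP => y yC; rewrite inE stC // perm_closed.
  apply: perm_onM; [apply: subset_trans sC CB | apply: subset_trans tD _].
  exact: subsetDl.
apply/eqP; congr pair; apply/permP => y.
  have [yC|yC] := boolP (y \in C); first by rewrite (restr_permE nC yC) stC.
  by rewrite !(out_perm _ yC) ?restr_perm_on.
have [yD|yD] := boolP (y \in D); first by rewrite (restr_permE nD yD) stD.
by rewrite !(out_perm _ yD) ?restr_perm_on.
Qed.

(** The exponential formula for pairs, in the form of the recursion that takes
    out the component C of a marked point x. *)
Lemma perm_sum_mul a b B x : x \in B ->
  perm_sum a B * perm_sum b B =
  \sum_(C : {set T} | (x \in C) && (C \subset B))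
    conn_sum a b x C * (perm_sum a (B :\: C) * perm_sum b (B :\: C)).
Proof.
move=> xB; rewrite /perm_sum big_distrlr /= pair_big /=.
rewrite (partition_big (fun st => porbit2 st.1 st.2 x)
  (fun C : {set T} => (x \in C) && (C \subset B))) /=; last first.
  move=> [s t] /= /andP[/perm_on_stable sB /perm_on_stable tB].
  by rewrite porbit2_id porbit2_sub.
apply: eq_bigr => C /andP[xC CB].
set D := B :\: C.
have dCD : [disjoint C & D] by rewrite -setI_eq0 /D setDE setICA setICr setI0.
have dDC : [disjoint D & C] by rewrite disjoint_sym.
have eB : B = C :|: D by rewrite -[LHS](setID B C) (setIidPr CB).
pose G s t := if porbit2 s t x == C then cycle_weight a B s * cycle_weight b B t else 0.
transitivity (\sum_(s | perm_on B s && (C \subset s @^-1: C))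
              \sum_(t | perm_on B t && (C \subset t @^-1: C)) G s t).
  rewrite pair_big /= big_mkcond [RHS]big_mkcond; apply: eq_bigr => -[s t] _ /=.
  rewrite /G; case: eqP => [e|_]; last by rewrite andbF; case: ifP.
  have [sC tC] := porbit2_stable s t x; rewrite e in sC tC.
  have -> : C \subset s @^-1: C by apply/subsetP => y yC; rewrite inE sC.
  have -> : C \subset t @^-1: C by apply/subsetP => y yC; rewrite inE tC.
  by rewrite !andbT.
have GE s1 s2 t1 t2 : perm_on C s1 -> perm_on D s2 -> perm_on C t1 -> perm_on D t2 ->
    G (s1 * s2)%g (t1 * t2)%g =
    (if porbit2 s1 t1 x == C then cycle_weight a C s1 * cycle_weight b C t1 else 0)
      * (cycle_weight a D s2 * cycle_weight b D t2).
  have W c r1 r2 : perm_on C r1 -> perm_on D r2 ->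
      [/\ stable (r1 * r2)%g C, {in C, (r1 * r2)%g =1 r1} &
      cycle_weight c B (r1 * r2)%g = cycle_weight c C r1 * cycle_weight c D r2].
    move=> r1C r2D.
    have eC : {in C, (r1 * r2)%g =1 r1}.
      move=> y yC; rewrite permM (out_perm r2D) // !inE negb_and negbK.
      by rewrite perm_closed ?yC.
    have eD : {in D, (r1 * r2)%g =1 r2}.
      by move=> y yD; rewrite permM (out_perm r1C) //; move: yD; rewrite inE => /andP[].
    have rC : stable (r1 * r2)%g C by move=> y yC; rewrite eC // perm_closed.
    have rD : stable (r1 * r2)%g D by move=> y yD; rewrite eD // perm_closed.
    split=> //; rewrite {1}eB cycle_weight_split //.
    by rewrite (cycle_weight_agree _ rC eC) (cycle_weight_agree _ rD eD).
  move=> h1 h2 h3 h4; rewrite /G.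
  have [sC es ->] := W a _ _ h1 h2; have [tC et ->] := W b _ _ h3 h4.
  rewrite (porbit2_agree sC tC es et xC); case: eqP => _; last by rewrite mul0r.
  by rewrite mulrACA.
rewrite sum_stable_split // /conn_sum mulr_suml; apply: eq_bigr => s1 h1.
rewrite mulr_suml (eq_bigr (fun s2 => \sum_(t1 | perm_on C t1) \sum_(t2 | perm_on D t2)
  G (s1 * s2)%g (t1 * t2)%g)) => [|s2 _]; last by rewrite sum_stable_split.
rewrite exchange_big /= big_mkcondr; apply: eq_bigr => t1 h3 /=.
rewrite (eq_bigr (fun s2 => \sum_(t2 | perm_on D t2)
   (if porbit2 s1 t1 x == C then cycle_weight a C s1 * cycle_weight b C t1 else 0)
      * (cycle_weight a D s2 * cycle_weight b D t2))) => [|s2 h2]; last first.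
  by apply: eq_bigr => t2 h4; exact: GE.
rewrite big_distrlr /= mulr_sumr.
case: ifP => _; last first.
  by rewrite big1 // => s2 _; rewrite big1 // => t2 _; rewrite mul0r.
by apply: eq_bigr => s2 _; rewrite mulr_sumr.
Qed.

End Weights.

Local Open Scope ring_scope.

(** There are as many subsets of size k + 1 through a marked point as subsets of
    size k avoiding it. *)
Lemma sum_subsets_through (V : nmodType) (T : finType) (B : {set T}) x m (g : nat -> V) :
  x \in B -> #|B| = m.+1 ->
  \sum_(C : {set T} | (x \in C) && (C \subset B)) g #|C| =
  \sum_(k < m.+1) g k.+1 *+ 'C(m, k).
Proof.
move=> xB Bm; have Bx : #|B :\ x| = m by move: Bm; rewrite (cardsD1 x) xB => -[].
transitivity (\sum_(A : {set T} | A \subset B :\ x) g #|A|.+1).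
  rewrite (reindex_onto (fun A : {set T} => x |: A) (fun C : {set T} => C :\ x)) /=; last first.
    by move=> C /andP[xC _]; rewrite setD1K.
  apply: eq_big => [A|A /andP[/andP[_ _] /eqP e]]; last first.
    by rewrite cardsU1; have -> : x \notin A by rewrite -e !inE eqxx.
  rewrite subsetD1 !inE eqxx /= subUset sub1set xB /=; case: (A \subset B) => //=.
  apply/eqP/idP => [<-|xA]; first by rewrite !inE eqxx.
  by rewrite setU1K.
rewrite (partition_big (fun A : {set T} => inord #|A| : 'I_m.+1) xpredT) //=.
apply: eq_bigr => k _.
have -> : 'C(m, k) = #|[set A : {set T} | A \subset B :\ x & #|A| == k]|.
  by rewrite cards_draws Bx.
have lt (A : {set T}) : A \subset B :\ x -> (#|A| < m.+1)%N.
  by move=> /subset_leq_card; rewrite Bx.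
rewrite -sumr_const; apply: eq_big => A; last first.
  by move=> /andP[/lt AB /eqP <-]; rewrite inordK.
by rewrite inE; apply: andb_id2l => /lt AB; rewrite -val_eqE /= inordK.
Qed.

Lemma card_perm_on0 (T : finType) (s : {perm T}) : perm_on set0 s = (s == 1%g).
Proof.
apply/idP/eqP => [h|->]; last exact: perm_on1.
by apply: (perm_on_id h); rewrite cards0.
Qed.

Section ExponentialFormula.
Variables (R : numFieldType) (T : finType).
Implicit Types (x y z : T) (A B C : {set T}) (a b : nat -> R).

Lemma perm_sum0 a : perm_sum a (set0 : {set T}) = 1.
Proof.
rewrite /perm_sum (eq_bigl (pred1 1%g)) => [|s]; last by rewrite card_perm_on0.
by rewrite big_pred1_eq /cycle_weight imset0 big_set0.
Qed.

Lemma perm_sum1 B : perm_sum (fun=> 1) B = #|B|`!%:R :> R.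
Proof.
rewrite /perm_sum (eq_bigr (fun=> 1)) => [|s _]; last by rewrite /cycle_weight big1.
by rewrite sumr_const card_perm.
Qed.

(** With these weights only the identity contributes, so a pair sum becomes a sum
    over single permutations. *)
Definition unit_weight (k : nat) : R := (k == 1%N)%:R.

Lemma cycle_weight_unit B (t : {perm T}) : perm_on B t ->
  cycle_weight unit_weight B t = (t == 1%g)%:R.
Proof.
move=> tB; have [->|t1] := eqVneq t 1%g.
  rewrite /cycle_weight big1 // => _ /imsetP[x _ ->].
  rewrite /unit_weight (_ : porbit 1 x = [set x]) ?cards1 //.
  apply/setP => y; rewrite inE; apply/idP/eqP => [/porbitP[i ->]|->].
    by rewrite expg1n perm1.
  exact: porbit_id.
have /existsP[x tx] : [exists x, t x != x].
  apply: contraNT t1 => /existsPn h; apply/eqP/permP => x; rewrite perm1.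
  by apply/eqP/negPn; exact: h.
have xB : x \in B by apply: contraNT tx => xB; rewrite (out_perm tB).
rewrite /cycle_weight (bigD1 (porbit t x)) ?imset_f //= /unit_weight.
case: eqP => [/eqP/cards1P[y e]|_]; last by rewrite mul0r.
by move: (porbit_step t x) (porbit_id t x) tx; rewrite e !inE => /eqP-> /eqP<-; rewrite eqxx.
Qed.

Lemma perm_sum_unit B : perm_sum unit_weight B = 1.
Proof.
rewrite /perm_sum (bigD1 1%g) ?perm_on1 //= cycle_weight_unit ?perm_on1 // eqxx.
by rewrite big1 ?addr0 // => t /andP[tB /negPf t1]; rewrite cycle_weight_unit // t1.
Qed.

Lemma porbit2_1 (s : {perm T}) x : porbit2 s 1 x = porbit s x.
Proof.
apply/eqP; rewrite eqEsubset; apply/andP; split.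
  apply: porbit2_sub; rewrite ?porbit_id // => y; last by rewrite perm1.
  by move=> /porbit_eqP <-; exact: porbit_step.
apply/subsetP => y yx; have [h1 _] := porbit2_stable s 1 x.
exact: (@porbit_stable _ (mem (porbit2 s 1 x)) s x y h1 (porbit2_id _ _ _)).
Qed.

Definition full_cycles x C : nat := #|[set s | perm_on C s && (porbit s x == C)]|.

Lemma conn_sum_unit a x C : x \in C ->
  conn_sum a unit_weight x C = (full_cycles x C)%:R * a #|C|.
Proof.
move=> xC; rewrite /conn_sum /full_cycles mulr_natl -sumr_const [RHS]big_mkcond [LHS]big_mkcond.
apply: eq_bigr => s _; rewrite inE; case: ifP => //= sC.
rewrite big_mkcondr (bigD1 1%g) ?perm_on1 //= big1 ?addr0 => [|t /andP[tC t1]]; last first.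
  by rewrite cycle_weight_unit // (negPf t1) mulr0 if_same.
rewrite porbit2_1; case: eqP => // e.
rewrite cycle_weight_unit ?perm_on1 // eqxx mulr1 /cycle_weight.
rewrite (_ : porbit s @: C = [set C]) ?big_set1 //.
apply/setP => A; rewrite inE; apply/imsetP/eqP => [[y yC ->]|->]; last by exists x; rewrite ?e.
by rewrite -[RHS]e; apply/porbit_eqP; rewrite e.
Qed.

Lemma perm_sum_rec_cycles a B x : x \in B ->
  perm_sum a B = \sum_(C : {set T} | (x \in C) && (C \subset B))
    (full_cycles x C)%:R * a #|C| * perm_sum a (B :\: C).
Proof.
move=> xB; transitivity (perm_sum a B * perm_sum unit_weight B).
  by rewrite perm_sum_unit mulr1.
rewrite (perm_sum_mul _ _ xB).
by apply: eq_bigr => C /andP[xC _]; rewrite conn_sum_unit // perm_sum_unit mulr1.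
Qed.

(** Solved for from the recursion itself: with all weights equal to 1 the sums
    over permutations are factorials, and m! is the sum over k <= m - 1 of
    C(m-1, k) k! (m-1-k)!. *)
Lemma card_full_cycles x C : x \in C -> full_cycles x C = #|C|.-1`!.
Proof.
move: {2}#|C| (leqnn #|C|) => m; elim: m C => [|m IH] C.
  by rewrite leqn0 cards_eq0 => /eqP->; rewrite inE.
move=> Cm xC; have [k Ck] : exists k, #|C| = k.+1 by exists #|C|.-1; rewrite prednK // (cardD1 x) xC.
have := perm_sum_rec_cycles (fun=> 1) xC; rewrite perm_sum1.
(* the same recursion with the expected numbers of cycles *)
have key : #|C|`!%:R = \sum_(A : {set T} | (x \in A) && (A \subset C))
    (#|A|.-1`! * (#|C| - #|A|)`!)%:R :> R.
  rewrite (sum_subsets_through (fun j => (j.-1`! * (#|C| - j)`!)%:R) xC Ck) Ck /=.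
  rewrite (eq_bigr (fun=> k`!%:R)) => [|i _]; last first.
    by rewrite -mulrnA subSS mulnC bin_fact // -ltnS.
  by rewrite sumr_const card_ord -mulrnA mulnC.
rewrite key (bigD1 C) ?xC ?subxx //= [in RHS](bigD1 C) ?xC ?subxx //=.
rewrite setDv perm_sum0 !mulr1 subnn muln1.
have -> : \sum_(A : {set T} | (x \in A) && (A \subset C) && (A != C))
     (#|A|.-1`! * (#|C| - #|A|)`!)%:R =
  \sum_(A : {set T} | (x \in A) && (A \subset C) && (A != C))
     (full_cycles x A)%:R * 1 * perm_sum (fun=> 1) (C :\: A) :> R.
  apply: eq_bigr => A /andP[/andP[xA AC] nAC].
  rewrite IH // ?perm_sum1 ?mulr1 ?natrM ?cardsD ?(setIidPr AC) //.
  have : A \proper C by rewrite properEneq nAC.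
  by move/proper_card; lia.
by move=> /addIr/eqP; rewrite eqr_nat => /eqP->.
Qed.

(** The recursion for f says that its exponential generating series is the
    exponential of the sum of a_k x^k / k. *)
Lemma perm_sum_exp a (f : nat -> R) N : f 0 = 1 ->
  (forall m, (m < N)%N -> f m.+1 = \sum_(k < m.+1) 'C(m, k)%:R * k`!%:R * a k.+1 * f (m - k)%N) ->
  forall B, (#|B| <= N)%N -> perm_sum a B = f #|B|.
Proof.
move=> f0 fS B; move: {2}#|B| (leqnn #|B|) => n; elim: n B => [|n IH] B.
  by rewrite leqn0 cards_eq0 => /eqP-> _; rewrite cards0 perm_sum0 f0.
move=> Bn BN; have [->|/set0Pn[x xB]] := eqVneq B set0; first by rewrite cards0 perm_sum0 f0.
have [m Bm] : exists m, #|B| = m.+1 by exists #|B|.-1; rewrite prednK // (cardD1 x) xB.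
rewrite (perm_sum_rec_cycles _ xB) Bm fS; last by rewrite -Bm.
transitivity (\sum_(C : {set T} | (x \in C) && (C \subset B))
    (#|C|.-1`!%:R * a #|C| * f (#|B| - #|C|)%N)).
  apply: eq_bigr => C /andP[xC CB]; rewrite card_full_cycles //.
  have C0 : (0 < #|C|)%N by rewrite (cardD1 x) xC.
  have CB' := subset_leq_card CB.
  by rewrite IH ?cardsD ?(setIidPr CB) //; lia.
rewrite (sum_subsets_through (fun j => j.-1`!%:R * a j * f (#|B| - j)%N) xB Bm).
by apply: eq_bigr => k _; rewrite Bm subSS -[LHS]mulr_natl !mulrA.
Qed.

(** Taking logarithms: if the sums for w are the products of those for a and b
    on all subsets, then the connected parts agree.  The marked-point recursions
    of both sides coincide in all components other than B itself. *)
Lemma conn_sum_eq w a b B x : x \in B ->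
  (forall C, C \subset B -> perm_sum w C = perm_sum a C * perm_sum b C) ->
  #|B|.-1`!%:R * w #|B| = conn_sum a b x B.
Proof.
move: {2}#|B| (leqnn #|B|) => n; elim: n B => [|n IH] B.
  by rewrite leqn0 cards_eq0 => /eqP->; rewrite inE.
move=> Bn xB H; have := H B (subxx B).
rewrite (perm_sum_mul _ _ xB) (perm_sum_rec_cycles _ xB).
rewrite (bigD1 B) ?xB ?subxx //= [in RHS](bigD1 B) ?xB ?subxx //=.
rewrite setDv !perm_sum0 !mulr1 card_full_cycles //.
set S1 := \sum_(_ | _) _; set S2 := \sum_(_ | _) _.
suff -> : S1 = S2 by move/addIr.
apply: eq_bigr => C /andP[/andP[xC CB] nCB].
rewrite card_full_cycles // IH //.
- by rewrite H ?subsetDl.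
- have : C \proper B by rewrite properEneq nCB.
  by move/proper_card; lia.
- by move=> D DC; apply: H; apply: subset_trans DC CB.
Qed.

End ExponentialFormula.

(** * Transitive pairs and their genus expansion *)

Section CycleCounts.
Variable T : finType.
Implicit Types s : {perm T}.

Lemma card_porbits_gt0 s (x : T) : (0 < #|porbits s|)%N.
Proof. by apply/card_gt0P; exists (porbit s x); rewrite imset_f. Qed.

Lemma sum_card_porbits_pred s : (\sum_(C in porbits s) #|C|.-1 + #|porbits s| = #|T|)%N.
Proof.
rewrite -sum1_card -big_split /=.
have := card_partition (porbits_partition s); rewrite cardsT => ->.
by apply: eq_bigr => _ /imsetP[x _ ->]; rewrite addn1 prednK // lt0n card_porbit_neq0.
Qed.

End CycleCounts.

Section TransitiveSum.
Variables (R : numFieldType) (n : nat).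
Hypothesis n_gt0 : (0 < n)%N.
Implicit Types (u v w : nat -> R) (y d : R).

(** To be used at y = -1/d.  The exponent is a natural number because transitive
    pairs satisfy [transitive_card_porbits]. *)
Definition transitive_sum y u v : R :=
  (\sum_(st : 'S_n * 'S_n | transitive2 st.1 st.2)
     y ^+ (n.+1 - (#|porbits st.1| + #|porbits st.2|)) *
       (mult_ext_perm u st.1 * mult_ext_perm v st.2)) / n.-1`!%:R.

(** Over the cycles of a permutation, the signs multiply to its signature and the
    factors d count the cycles. *)
Definition signed_weight d u (k : nat) : R := (-1) ^+ k.-1 * d * u k.

Lemma mult_ext_perm_signed d u (s : 'S_n) :
  mult_ext_perm (signed_weight d u) s =
  (-1) ^+ (n - #|porbits s|) * d ^+ #|porbits s| * mult_ext_perm u s.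
Proof.
rewrite /mult_ext_perm /mult_ext !big_split /= prodr_const; congr (_ * _ * _).
have <- : (\sum_(C in porbits s) #|C|.-1 = n - #|porbits s|)%N.
  have := sum_card_porbits_pred s; rewrite card_ord.
  by set a := (\sum_(_ in _) _)%N; card_lia.
by rewrite prodrXr.
Qed.

Lemma transitive_card_porbits (s t : 'S_n) : transitive2 s t ->
  (#|porbits s| + #|porbits t| <= n.+1)%N.
Proof.
move=> /card_porbits_transitive2; rewrite card_ord.
by have := card_porbits_gt0 (t * s)%g (Ordinal n_gt0); card_lia.
Qed.

(** The exact formula behind the whole proof.  The factors d^|C| in the hypothesis
    are absorbed in the weights of w; the signs combine because
    (n - |s|) + (n - |t|) = (n - 1) + (n + 1 - |s| - |t|). *)
Lemma transitive_sum_signed d u v w : d != 0 ->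
    (forall C : {set 'I_n}, d ^+ #|C| * perm_sum (signed_weight d w) C =
       perm_sum (signed_weight d u) C * perm_sum (signed_weight d v) C) ->
  w n = transitive_sum (- d^-1) u v.
Proof.
move=> d0 H; pose x : 'I_n := Ordinal n_gt0.
pose w' k := d ^+ k * signed_weight d w k.
have Hw (C : {set 'I_n}) : perm_sum w' C = d ^+ #|C| * perm_sum (signed_weight d w) C.
  rewrite /perm_sum mulr_sumr; apply: eq_bigr => s sC.
  rewrite /cycle_weight big_split /= prodrXr; congr (d ^+ _ * _).
  have sS := perm_on_stable sC.
  have trs : trivIset (porbit s @: C).
    apply: trivIsetS (partition_trivIset (porbits_partition s)).
    by apply: imsetS; apply/subsetP.
  have eC : C = cover (porbit s @: C).
    rewrite cover_imset; apply/setP => y; apply/idP/bigcupP => [yC|[z zC yz]].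
      by exists y; rewrite ?porbit_id.
    exact: (@porbit_stable _ (mem C) s z y sS zC yz).
  by rewrite [in RHS]eC; apply/eqP.
have := conn_sum_eq (in_setT x) (fun C (_ : C \subset [set: 'I_n]) => etrans (Hw C) (H C)).
rewrite cardsT card_ord => e.
have fn : n.-1`!%:R != 0 :> R by rewrite pnatr_eq0 -lt0n fact_gt0.
have sgn : (-1) ^+ n.-1 * d ^+ n.+1 != 0 :> R.
  by rewrite mulf_neq0 ?expf_neq0 ?oppr_eq0 ?oner_eq0.
apply: (mulfI sgn); apply: (mulfI fn).
rewrite /transitive_sum [RHS]mulrCA [_ * (_ / _)]mulrC divfK //.
transitivity (n.-1`!%:R * w' n).
  rewrite /w' /signed_weight exprS; ring.
rewrite e /conn_sum mulr_sumr.
transitivity (\sum_(s : 'S_n) \sum_(t : 'S_n | transitive2 s t)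
   mult_ext_perm (signed_weight d u) s * mult_ext_perm (signed_weight d v) t).
  apply: eq_big => [s|s _]; first by apply/subsetP => z _; rewrite inE.
  have W a (r : 'S_n) : cycle_weight a [set: 'I_n] r = mult_ext_perm a r.
    by apply: eq_bigl => A; apply/imsetP/imsetP => -[z _ ->]; exists z; rewrite ?inE.
  apply: eq_big => t; last by rewrite !W.
  rewrite (transitive2_porbit2 s t x).
  by rewrite (_ : perm_on _ _) //; apply/subsetP => z _; rewrite inE.
rewrite pair_big_dep /=; apply: eq_bigr => -[s t] /= tr.
have jn := transitive_card_porbits tr.
have sn : (#|porbits s| <= n)%N by rewrite -[X in (_ <= X)%N]card_ord leq_imset_card.
have tn : (#|porbits t| <= n)%N by rewrite -[X in (_ <= X)%N]card_ord leq_imset_card.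
rewrite !mult_ext_perm_signed mulrACA [RHS]mulrA; congr (_ * _).
move: jn sn tn; set j := #|porbits s|; set k := #|porbits t| => jn sn tn.
rewrite mulrACA -!exprD.
have -> : d ^+ n.+1 = d ^+ (n.+1 - (j + k)) * d ^+ (j + k) by rewrite -exprD subnK.
rewrite (exprNn d^-1) [RHS]mulrACA -exprD; congr (_ * _).
  by rewrite -exprD; congr (_ ^+ _); lia.
by rewrite [X in _ = X * _]exprD [RHS]mulrAC exprVn mulfV ?mul1r // expf_neq0.
Qed.

(** The expansion in powers of y.  At exponent 0 all n-cycles r = ts are
    conjugate, so (n-1)! copies of the sum over noncrossing partitions appear;
    at exponent 1 the product has two cycles. *)
Lemma transitive_sum_split y u v :
  transitive_sum y u v =
  \sum_(P in NC n) mult_ext u P * mult_ext v (Kr P)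
  + y * (n%:R / 2 * \sum_(1 <= t < n) \sum_(s in SNC t (n - t)%N)
           mult_ext_perm u s * mult_ext_perm v (Kr_ann s) / (t%:R * (n - t)%N%:R))
  + (\sum_(st : 'S_n * 'S_n | transitive2 st.1 st.2 &&
        (#|porbits st.1| + #|porbits st.2| < n)%N)
     y ^+ (n.+1 - (#|porbits st.1| + #|porbits st.2|)) *
       (mult_ext_perm u st.1 * mult_ext_perm v st.2)) / n.-1`!%:R.
Proof.
have fn : n.-1`!%:R != 0 :> R by rewrite pnatr_eq0 -lt0n fact_gt0.
pose c (st : 'S_n * 'S_n) := (#|porbits st.1| + #|porbits st.2|)%N.
pose F (st : 'S_n * 'S_n) := mult_ext_perm u st.1 * mult_ext_perm v st.2.
(* total n + 1: the product is an n-cycle *)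
have top : \sum_(st | transitive2 st.1 st.2 && (c st == n.+1)) F st =
    n.-1`!%:R * \sum_(P in NC n) mult_ext u P * mult_ext v (Kr P).
  rewrite [LHS](sum_transitive2 u v 'I_n n.+1) sum_planar_long_cycle //; congr (_ * _).
  transitivity (\sum_(s | geodesic s) mult_ext_perm u s * mult_ext_perm v (long_cycle n * s^-1)%g).
    by apply: eq_bigl => s; rewrite porbits1_transitive2 ?card_porbits_long_cycle.
  rewrite sum_geodesic //; apply: eq_bigr => P; rewrite inE => /andP[]; rewrite inE => pP _.
  by rewrite {1}/mult_ext_perm porbits_block_perm.
(* total n: the product has two cycles *)
have next : \sum_(st | transitive2 st.1 st.2 && (c st == n)) F st = n`!%:R / 2 *
    \sum_(1 <= t < n) \sum_(s in SNC t (n - t)%N)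
       mult_ext_perm u s * mult_ext_perm v (Kr_ann s) / (t%:R * (n - t)%N%:R).
  rewrite [LHS](sum_transitive2 u v 'I_n n) sum_planar_two_cycles //; congr (_ * _).
  apply: eq_bigr => t _; rewrite -mulr_suml; congr (_ / _).
  by apply: eq_bigl => s; rewrite inE.
rewrite /transitive_sum (bigID (fun st => c st == n.+1)) /= mulrDl -addrA; congr (_ + _).
  rewrite -[RHS](mulKf fn) -top mulrC; congr (_ * _); apply: eq_bigr => st /andP[_ /eqP].
  by rewrite -/(c st) => ->; rewrite subnn mul1r.
rewrite (bigID (fun st => c st == n)) /= mulrDl; congr (_ + _ / _).
  have -> : n%:R / 2 * \sum_(1 <= t < n) \sum_(s in SNC t (n - t)%N)
       mult_ext_perm u s * mult_ext_perm v (Kr_ann s) / (t%:R * (n - t)%N%:R) =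
     (\sum_(st | transitive2 st.1 st.2 && (c st == n)) F st) / n.-1`!%:R.
    have fe : n`! = (n.-1`! * n)%N by rewrite mulnC -{1}(prednK n_gt0) factS prednK.
    by rewrite next fe natrM; move: (\sum_(1 <= t < n) _) => S; field.
  rewrite mulrA; congr (_ / _); rewrite mulr_sumr; apply: eq_big => [st|st].
    by rewrite -andbA; congr (_ && _); apply: andb_idl => /eqP->; rewrite neq_ltn ltnSn.
  by move=> /andP[_ /eqP]; rewrite -/(c st) => ->; rewrite subSnn.
apply: eq_bigl => st; rewrite -!andbA; apply: andb_id2l => /transitive_card_porbits.
by rewrite -/(c st); lia.
Qed.

End TransitiveSum.

(** * Newton identities and cumulants as exponential formulas *)

Section Newton.
Variable F : numFieldType.
Implicit Types (z : F) (zs : seq F).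

Fixpoint elem_sym zs k : F :=
  if zs is z :: s then elem_sym s k + (if k is k'.+1 then z * elem_sym s k' else 0)
  else (k == 0)%:R.

Definition power_sum zs k : F := \sum_(z <- zs) z ^+ k.

Arguments elem_sym : simpl never.

Lemma elem_sym_consS z zs k :
  elem_sym (z :: zs) k.+1 = elem_sym zs k.+1 + z * elem_sym zs k.
Proof. by []. Qed.

Lemma elem_sym0 zs : elem_sym zs 0 = 1.
Proof. by elim: zs => // z s IH; rewrite -[LHS]/(elem_sym s 0 + 0) IH addr0. Qed.

Lemma elem_sym_oversize zs k : (size zs < k)%N -> elem_sym zs k = 0.
Proof.
elim: zs k => [|z s IH] [|k] //= h.
by rewrite elem_sym_consS !IH ?mulr0 ?addr0 // ltnW.
Qed.

(** Induction on the list of roots: the terms that the new root adds to the power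
    sums form a telescoping sum. *)
Lemma newton_identity zs m :
  m.+1%:R * elem_sym zs m.+1 =
  \sum_(k < m.+1) (-1) ^+ k * power_sum zs k.+1 * elem_sym zs (m - k)%N.
Proof.
elim: zs m => [|z s IH] m.
  rewrite mulr0 big1 // => k _; by rewrite /power_sum big_nil mulr0 mul0r.
(* the contribution of the new root telescopes *)
have tel j : \sum_(k < j.+1) (-1) ^+ k * z ^+ k.+1 * elem_sym (z :: s) (j - k)%N =
    z * elem_sym s j.
  elim: j => [|j IHj]; first by rewrite big_ord1 /= !elem_sym0 expr0 mul1r.
  rewrite big_ord_recl /= subn0 expr0 mul1r expr1 elem_sym_consS.
  rewrite (eq_bigr (fun k : 'I_j.+1 => - z *
     ((-1) ^+ k * z ^+ k.+1 * elem_sym (z :: s) (j - k)%N))) => [|k _].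
    by rewrite -mulr_sumr IHj; ring.
  by rewrite /bump leq0n add1n subSS !exprS; ring.
transitivity (\sum_(k < m.+1) ((-1) ^+ k * power_sum s k.+1 * elem_sym (z :: s) (m - k)%N
   + (-1) ^+ k * z ^+ k.+1 * elem_sym (z :: s) (m - k)%N)); last first.
  by apply: eq_bigr => k _; rewrite /power_sum big_cons; ring.
rewrite big_split tel /=.
rewrite elem_sym_consS mulrDr IH; case: m => [|m].
  by rewrite !big_ord1 /= !elem_sym0; ring.
rewrite big_ord_recr [X in _ = X + _]big_ord_recr /= subnn !elem_sym0.
rewrite [X in _ = X + _ + _](eq_bigr (fun k : 'I_m.+1 =>
   (-1) ^+ k * power_sum s k.+1 * elem_sym s (m.+1 - k)%N
   + z * ((-1) ^+ k * power_sum s k.+1 * elem_sym s (m - k)%N))) => [|k _].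
  by rewrite big_split -mulr_sumr -IH /= -[m.+2]addn1 natrD; ring.
by rewrite subSn -1?ltnS // elem_sym_consS; ring.
Qed.

Lemma coef_prod_XsubC_elem zs k : (k <= size zs)%N ->
  (\prod_(z <- zs) ('X - z%:P))`_(size zs - k)%N = (-1) ^+ k * elem_sym zs k.
Proof.
elim: zs k => [|z s IH] k; first by rewrite leqn0 => /eqP->; rewrite big_nil coef1 elem_sym0 mulr1.
move=> /= ks; rewrite big_cons mulrBl coefB coefCM coefXM.
have over : (\prod_(z <- s) ('X - z%:P))`_(size s).+1 = 0.
  by rewrite nth_default // size_prod_XsubC.
case: k ks => [|k] ks.
  have := IH 0 isT; rewrite !subn0 over !elem_sym0 => ->; by rewrite mulr0 subr0.
rewrite elem_sym_consS subSS IH // (_ : ((size s - k).-1 = size s - k.+1)%N); last by lia.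
rewrite subn_eq0; case: ltnP => [lt|le].
  by rewrite IH // exprS; ring.
by rewrite (@elem_sym_oversize s k.+1) // exprS; ring.
Qed.

(** Newton's identities are the recursion of [perm_sum_exp]. *)
Lemma perm_sum_power_sum (T : finType) zs (B : {set T}) :
  perm_sum (fun k => (-1) ^+ k.-1 * power_sum zs k) B = #|B|`!%:R * elem_sym zs #|B|.
Proof.
apply: (@perm_sum_exp _ _ _ (fun m => m`!%:R * elem_sym zs m) #|B|) => //.
  by rewrite elem_sym0 mulr1.
move=> m _; rewrite factS mulnC natrM -mulrA newton_identity mulr_sumr.
apply: eq_bigr => k _; have km : (k <= m)%N by rewrite -ltnS.
by rewrite -(bin_fact km) !natrM; ring.
Qed.
End Newton.

Section LogCumulants.
Variables (R : numFieldType) (e : nat -> R).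

(** The coefficients of the logarithm of the exponential generating series of e,
    as in the definition of the finite free cumulants, but for partitions of an
    arbitrary finite set. *)
Definition log_coef_set (T : finType) (C : {set T}) : R :=
  \sum_(P | partition P C) (-1) ^+ #|P|.-1 * #|P|.-1`!%:R * mult_ext e P.

Definition log_coef n : R := log_coef_set [set: 'I_n].

(** Transport of partitions along an enumeration of C. *)
Lemma log_coef_card (T : finType) (C : {set T}) : log_coef_set C = log_coef #|C|.
Proof.
pose h : 'I_#|C| -> T := @enum_val T (mem C).
have h_inj : injective h := @enum_val_inj _ _.
have hC : h @: [set: 'I_#|C|] = C.
  apply/setP => y; apply/imsetP/idP => [[i _ ->]|yC]; first exact: enum_valP.
  by exists (enum_rank_in yC y); rewrite // /h enum_rankK_in.
rewrite /log_coef /log_coef_set.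
rewrite (reindex_onto (fun P : {set {set 'I_#|C|}} => [set h @: (V : {set 'I_#|C|}) | V in P])
   (fun P : {set {set T}} => [set h @^-1: (V : {set T}) | V in P])) /=; last first.
  move=> P pP; rewrite -imset_comp -[RHS]imset_id; apply: eq_in_imset => V VP /=.
  apply/setP => y; apply/imsetP/idP => [[i iV ->]|yV]; first by rewrite inE in iV.
  have /imsetP[i _ e'] : y \in h @: [set: 'I_#|C|] by rewrite hC (subsetP (partitionS pP VP)).
  by exists i; rewrite ?inE -?e'.
apply: eq_big => [P|P _]; last first.
  have cP : #|[set h @: (V : {set 'I_#|C|}) | V in P]| = #|P|.
    by rewrite card_imset //; apply: imset_inj.
  rewrite cP /mult_ext big_imset /=; last by move=> U V _ _; apply: imset_inj.
  by congr (_ * _); apply: eq_bigr => V _; rewrite card_imset.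
have -> : [set h @^-1: (V : {set T}) | V in [set h @: (V : {set 'I_#|C|}) | V in P]] = P.
  rewrite -imset_comp -[RHS]imset_id; apply: eq_imset => V /=.
  by apply/setP => i; rewrite inE mem_imset.
by rewrite eqxx andbT -(imset_partition P [set: _] h_inj) hC.
Qed.

Hypothesis e0 : e 0 = 1.

(** The sum over k runs over the subsets C through a marked point.  For C
    different from the whole set, a partition of C together with the complement
    of C is a partition Q of the whole set with a chosen block that avoids the
    marked point.  There are |Q| - 1 such blocks, so the term of C equal to the
    whole set cancels the others, except when Q has one block. *)
Lemma log_coef_rec m :
  e m.+1 = \sum_(k < m.+1) 'C(m, k)%:R * log_coef k.+1 * e (m - k)%N.
Proof.
pose T := 'I_m.+1; pose x : T := ord0.
have cT : #|[set: T]| = m.+1 by rewrite cardsT card_ord.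
transitivity (\sum_(C : {set T} | (x \in C) && (C \subset [set: T]))
    log_coef_set C * e (m.+1 - #|C|)%N); last first.
  rewrite (eq_bigr (fun C : {set T} => log_coef #|C| * e (m.+1 - #|C|)%N)); last first.
    by move=> C _; rewrite log_coef_card.
  rewrite (sum_subsets_through (fun k => log_coef k * e (m.+1 - k)%N) (in_setT x) cT).
  by apply: eq_bigr => k _; rewrite subSS -[LHS]mulr_natl mulrA.
rewrite (bigD1 [set: T]) ?inE ?subxx //= cT subnn e0 mulr1 /log_coef_set.
transitivity (\sum_(Q : {set {set T}} | partition Q [set: T])
   (((-1) ^+ #|Q|.-1 * #|Q|.-1`!%:R) * mult_ext e Q
   + \sum_(V in Q | x \notin V) (-1) ^+ #|Q|.-2 * #|Q|.-2`!%:R * mult_ext e Q)).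
  have tr : partition [set [set: T]] [set: T].
    by have := trivial_partition_NC m; rewrite inE => /andP[]; rewrite inE.
  rewrite (bigD1 [set [set: T]]) //= [X in _ = _ + X]big1 ?addr0 => [|Q /andP[pQ nQ]].
    rewrite [X in _ = _ + X]big1 ?addr0 => [|V /andP[]]; last first.
      by rewrite inE => /eqP->; rewrite in_setT.
    by rewrite cards1 /= expr0 !mul1r /mult_ext big_set1 cT.
  have [xQ xx] : (pblock Q x \in Q) * (x \in pblock Q x) := pblock_partition x pQ.
  have tQ := partition_trivIset pQ.
  rewrite sumr_const (_ : #|_| = #|Q|.-1); last first.
    rewrite (cardsD1 (pblock Q x) Q) xQ /=; apply: eq_card => V; rewrite !inE [RHS]andbC unfold_in.
    apply: andb_id2l => VQ; congr (~~ _); apply/idP/eqP => [xV|-> //].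
    by rewrite (def_pblock tQ VQ xV).
  have : (1 < #|Q|)%N.
    rewrite (cardsD1 (pblock Q x) Q) xQ ltnS card_gt0; apply: contraNN nQ => /eqP Q1.
    have eQ : Q = [set pblock Q x].
      by rewrite -{1}(setD1K xQ) Q1 setU0.
    have := cover_partition pQ; rewrite {1}eQ /cover big_set1 => <-.
    by rewrite {1}eQ.
  case: #|Q| => [|[|q]] // _; rewrite /= -mulr_natl factS natrM exprS; ring.
rewrite big_split /=; congr (_ + _).
rewrite (eq_bigr (fun C : {set T} => \sum_(P | partition P C)
   ((-1) ^+ #|P|.-1 * #|P|.-1`!%:R * mult_ext e P * e (m.+1 - #|C|)%N))); last first.
  by move=> C _; rewrite mulr_suml.
rewrite !pair_big_dep /=.
(* (Q, V) stands for the set C = complement of V with the partition Q minus V *)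
rewrite [RHS](reindex_onto (fun QV : {set {set T}} * {set T} => (~: QV.2, QV.1 :\ QV.2))
  (fun CP : {set T} * {set {set T}} => (~: CP.1 |: CP.2, ~: CP.1))) /=; last first.
  move=> [C P] /= /andP[/andP[_ nC] pP]; rewrite setCK; congr pair.
  rewrite setU1K //; apply: contraNN nC => CP.
  have CC := partitionS pP CP; rewrite -[C]setCK.
  have -> : ~: C = set0.
    apply/setP => y; rewrite !inE; apply/negbTE; rewrite negbK; apply: contraT => yC.
    by have := subsetP CC y; rewrite inE yC => /(_ isT); rewrite (negPf yC).
  by rewrite setC0.
apply: eq_big => [[Q V]|[Q V]] /=; rewrite ?setCK.
  rewrite !inE subsetT andbT.
  apply/and3P/andP => [[pQ VQ xV]|[/andP[/andP[xV nV] pQV] /eqP[eQ]]].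
    split; last by rewrite setD1K.
    have -> : ~: V != [set: T].
      by apply: contraNneq (partition_neq0 pQ VQ) => h; rewrite -[V]setCK h setCT.
    rewrite xV /=.
    by rewrite -setTD partitionD1.
  have V0 : V != set0 by apply: contraNneq nV => ->; rewrite setC0.
  split=> //; last by rewrite -eQ !inE eqxx.
  by rewrite -eQ -(setUCr V) partitionU1 // -setI_eq0 setICr.
move=> /and3P[pQ VQ xV].
rewrite [#|Q|](cardsD1 V) VQ /= /mult_ext (big_setD1 V) //= -!mulrA; congr (_ * (_ * _)).
rewrite mulrC; congr (_ * e _).
have := cardsC V; rewrite card_ord; card_lia.
Qed.
End LogCumulants.

(** * Inverting the moment-cumulant relation *)

Lemma card_block_gt0 (T : finType) (P : {set {set T}}) D V :
  partition P D -> V \in P -> (0 < #|V|)%N.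
Proof. by move=> pP VP; rewrite card_gt0 (partition_neq0 pP VP). Qed.

Lemma NC_partition n P : P \in NC n -> partition P [set: 'I_n].
Proof. by rewrite inE => /andP[]; rewrite inE. Qed.

Lemma card_block_lt (T : finType) (P : {set {set T}}) V :
  partition P [set: T] -> P != [set [set: T]] -> V \in P -> (#|V| < #|T|)%N.
Proof.
move=> pP nP VP; rewrite ltn_neqAle max_card andbT.
apply: contraNneq nP => cV.
have VT : V = [set: T] by apply/eqP; rewrite eqEcard subsetT cardsT cV /=.
rewrite eqEsubset andbC sub1set -VT VP /=.
apply/subsetP => B BP; rewrite inE; apply: contraT => BV.
have /trivIsetP tP := partition_trivIset pP.
have /= := tP _ _ BP VP BV; rewrite VT -setI_eq0 setIT => /eqP B0.
by have := partition_neq0 pP BP; rewrite B0 eqxx.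
Qed.

Section MomentCumulants.
Variables (R : comNzRingType) (m a : nat -> R).

(** The moment-cumulant relation is triangular: every noncrossing partition
    other than the one with a single block only involves smaller indices. *)
Lemma free_cumulant_unique : 
  (forall n, (0 < n)%N -> m n = \sum_(P in NC n) mult_ext a P) ->
  forall n, (0 < n)%N -> a n = free_cumulant m n.
Proof.
move=> H n; elim/ltn_ind: n => -[//|n] IH _.
have := H n.+1 isT; rewrite {1}(moment_free_cumulant m (ltn0Sn n)).
rewrite (bigD1 _ (trivial_partition_NC n)) [RHS](bigD1 _ (trivial_partition_NC n)) /=.
rewrite (eq_bigr (fun P => mult_ext a P)); last first.
  move=> P /andP[/NC_partition pP nP]; apply: eq_bigr => V VP.
  rewrite IH ?(card_block_gt0 pP VP) //.
  by have := card_block_lt pP nP VP; rewrite card_ord.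
by move/addIr; rewrite /mult_ext !big_set1 cardsT card_ord.
Qed.
End MomentCumulants.

Section FullCycles.
Variables (R : numFieldType) (n : nat).
Hypothesis n_gt0 : (0 < n)%N.
Implicit Types (s t : 'S_n).

Lemma card_porbits_eq1 s : (#|porbits s| == 1%N) = (porbits s == [set [set: 'I_n]]).
Proof.
apply/idP/eqP => [/cards1P[A eA]|->]; last by rewrite cards1.
by have := cover_partition (porbits_partition s); rewrite eA /cover big_set1 => <-.
Qed.

Definition top_coefficient (y : R) : R :=
  (\sum_(st : 'S_n * 'S_n | transitive2 st.1 st.2 && (#|porbits st.1| == 1%N))
     y ^+ (n.+1 - (#|porbits st.1| + #|porbits st.2|))) / n.-1`!%:R.

Definition lower_part (y : R) (u : nat -> R) : R :=
  (\sum_(st : 'S_n * 'S_n | transitive2 st.1 st.2 && (#|porbits st.1| != 1%N))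
     y ^+ (n.+1 - (#|porbits st.1| + #|porbits st.2|)) * mult_ext_perm u st.1) / n.-1`!%:R.

(** The factor u n appears exactly for the s with one cycle, so the exact formula
    for moments in terms of cumulants can be solved for the cumulant of highest
    index. *)
Lemma transitive_sum_top y u :
  transitive_sum n y u (fun=> 1) = u n * top_coefficient y + lower_part y u.
Proof.
rewrite /transitive_sum (bigID (fun st => #|porbits st.1| == 1%N)) /= mulrDl.
have one (t : 'S_n) : mult_ext_perm (fun=> 1 : R) t = 1 by rewrite /mult_ext_perm /mult_ext big1.
congr (_ + _ / _); last by apply: eq_bigr => st _; rewrite one mulr1.
rewrite mulrA mulr_sumr; congr (_ / _); apply: eq_bigr => st /andP[_ s1].
rewrite one mulr1 mulrC; congr (_ * _).
move: s1; rewrite card_porbits_eq1 /mult_ext_perm => /eqP->.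
by rewrite /mult_ext big_set1 cardsT card_ord.
Qed.

(** All terms are nonnegative at y = 0, and the pair (long cycle, 1) contributes
    1. *)
Lemma top_coefficient0_neq0 : top_coefficient 0 != 0.
Proof.
rewrite /top_coefficient mulf_neq0 ?invr_eq0 ?pnatr_eq0 -?lt0n ?fact_gt0 //.
have l1 := card_porbits_long_cycle n_gt0.
rewrite lt0r_neq0 // (bigD1 (long_cycle n, 1%g)) /=; last first.
  by rewrite l1 -transitive2_mul mul1g porbits1_transitive2 // l1.
rewrite l1 card_porbits1 card_ord add1n subnn expr0 ltr_pwDl ?ltr01 //.
by apply: sumr_ge0 => st _; rewrite exprn_ge0.
Qed.
End FullCycles.

From mathcomp Require Import complex reals.

(** * Exact identities for finite free convolution *)

Lemma rmorph_perm_sum (R S : comNzRingType) (f : {rmorphism R -> S}) (T : finType)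
    (a : nat -> R) (B : {set T}) :
  f (perm_sum a B) = perm_sum (fun k => f (a k)) B.
Proof.
by rewrite rmorph_sum; apply: eq_bigr => s _; rewrite rmorph_prod.
Qed.

Lemma eq_perm_sum (R : comNzRingType) (T : finType) (a b : nat -> R) (B : {set T}) :
  (forall k, (0 < k)%N -> a k = b k) -> perm_sum a B = perm_sum b B.
Proof.
move=> ab; apply: eq_bigr => s _; apply: eq_bigr => _ /imsetP[x _ ->].
by rewrite ab // lt0n card_porbit_neq0.
Qed.

Section PolynomialIdentities.
Variable R : realType.
Implicit Types (p q : {poly R}) (d n k : nat).

Definition monic_degree d p := p \is monic /\ size p = d.+1.

Lemma nesym0 d p : monic_degree d p -> Defs.nesym d p 0 = 1.
Proof.
case=> /monicP mp sp; rewrite /Defs.nesym subn0 bin0 divr1 mul1r.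
by rewrite -mp lead_coefE sp.
Qed.

(** The product |C|! C(d, |C|) is the falling factorial of d.  The roots are
    complex, so the identity is proved there and pulled back. *)
Lemma perm_sum_moment d p (T : finType) (C : {set T}) : monic_degree d p ->
    (0 < d)%N -> (#|C| <= d)%N ->
  perm_sum (signed_weight d%:R (poly_moment d p)) C =
  (#|C|`! * 'C(d, #|C|))%:R * Defs.nesym d p #|C|.
Proof.
move=> [mp sp] d0 Cd; apply: (@fmorph_inj _ _ (real_complex R)).
have d0' : d%:R != 0 :> R[i] by rewrite pnatr_eq0 -lt0n.
have eP := complex_rootsE mp.
have szs : size (complex_roots p) = d.
  have := congr1 (fun P : {poly R[i]} => size P) eP.
  by rewrite size_prod_XsubC size_map_poly sp => -[].
rewrite rmorph_perm_sum.
rewrite (@eq_perm_sum _ _ _ (fun k => (-1) ^+ k.-1 * power_sum (complex_roots p) k)).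
  rewrite perm_sum_power_sum rmorphM /= rmorph_nat natrM -!mulrA; congr (_ * _).
  have C0 : 'C(d, #|C|)%:R != 0 :> R[i] by rewrite pnatr_eq0 -lt0n bin_gt0.
  rewrite /Defs.nesym fmorph_div rmorphM rmorphXn rmorphN1 rmorph_nat /=.
  rewrite mulrC divfK //.
  have -> : real_complex R p`_(d - #|C|) = (\prod_(z <- complex_roots p) ('X - z%:P))`_(d - #|C|).
    by rewrite -eP coef_map.
  rewrite -szs coef_prod_XsubC_elem; last by rewrite szs.
  by rewrite mulrA -expr2 sqrr_sign mul1r.
move=> k k0; rewrite /signed_weight !rmorphM rmorphXn rmorphN1 rmorph_nat /=.
rewrite -[real_complex _ (poly_moment _ _ _)](complex_moment_real d k mp) /complex_moment.
by rewrite -mulrA; congr (_ * _); rewrite mulrC divfK.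
Qed.

(** The constant sequence 1 consists of the moments of (X - 1)^d. *)
Lemma perm_sum_one d (T : finType) (C : {set T}) :
  perm_sum (signed_weight d%:R (fun=> 1)) C = (#|C|`! * 'C(d, #|C|))%:R :> R.
Proof.
have e k : elem_sym (nseq d (1 : R)) k = 'C(d, k)%:R.
  elim: d k => [|m IH] [|k]; rewrite ?elem_sym0 ?bin0 //.
  by rewrite -[nseq _ _]/(1 :: nseq m 1) elem_sym_consS !IH mul1r -natrD binS.
rewrite natrM -e -perm_sum_power_sum; apply: eq_perm_sum => k k0.
rewrite /signed_weight mulr1 /power_sum big_nseq.
by rewrite iter_addr_0 expr1n.
Qed.

(** The normalisation of the cumulants is such that the signed weight of index
    k is d^k/(k-1)! times the k-th coefficient of the logarithm of e. *)
Lemma perm_sum_cumulant d p (T : finType) (C : {set T}) : monic_degree d p ->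
  perm_sum (signed_weight d%:R (finite_free_cumulant d p)) C =
  d%:R ^+ #|C| * Defs.nesym d p #|C|.
Proof.
move=> mp; apply: (@perm_sum_exp _ _ _ (fun m => d%:R ^+ m * Defs.nesym d p m) #|C|) => //.
  by rewrite nesym0 // mulr1.
move=> m _; rewrite (log_coef_rec (nesym0 mp)) mulr_sumr; apply: eq_bigr => k _.
have km : (k <= m)%N by rewrite -ltnS.
have -> : d%:R ^+ m.+1 = d%:R ^+ k.+1 * d%:R ^+ (m - k) :> R.
  by rewrite -exprD addSn subnKC.
rewrite /signed_weight /finite_free_cumulant /=.
have -> : \sum_(P in set_partitions k.+1)
    (-1) ^+ #|P|.-1 * #|P|.-1`!%:R * mult_ext (Defs.nesym d p) P = log_coef (Defs.nesym d p) k.+1.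
  by apply: eq_bigl => P; rewrite inE.
rewrite (exprNn d%:R) exprS; have fk : k`!%:R != 0 :> R by rewrite pnatr_eq0 -lt0n fact_gt0.
have s1 : (-1) ^+ k * (-1) ^+ k = 1 :> R by rewrite -expr2 sqrr_sign.
move: s1; move: (log_coef _ _) ((-1) ^+ k) => L s s1.
by rewrite -[LHS]mul1r -[X in X * _ = _]s1; field.
Qed.

Lemma fmul_convE d p q k : (k <= d)%N ->
  (fmul_conv d p q)`_(d - k) = (-1) ^+ k * 'C(d, k)%:R * Defs.nesym d p k * Defs.nesym d q k.
Proof.
move=> kd; rewrite /fmul_conv coef_sum.
have kd' : (k < d.+1)%N by [].
rewrite (bigD1 (Ordinal kd')) //= coefZ coefXn eqxx mulr1 big1 ?addr0 // => i ik.
rewrite coefZ coefXn; case: eqP => [e|_]; last by rewrite mulr0.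
have : i = k :> nat by have := ltn_ord i; lia.
by move/eqP: ik => ik e'; case: ik; apply: val_inj.
Qed.

Lemma nesym_fmul_conv d p q k : (k <= d)%N ->
  Defs.nesym d (fmul_conv d p q) k = Defs.nesym d p k * Defs.nesym d q k.
Proof.
move=> kd; have C0 : 'C(d, k)%:R != 0 :> R by rewrite pnatr_eq0 -lt0n bin_gt0.
transitivity ((-1) ^+ k * (fmul_conv d p q)`_(d - k) / 'C(d, k)%:R); first by [].
rewrite fmul_convE //; move: (Defs.nesym d p k) (Defs.nesym d q k) => a b.
by rewrite !mulrA -expr2 sqrr_sign mul1r; field.
Qed.

Lemma fmul_conv_monic_degree d p q : monic_degree d p -> monic_degree d q ->
  monic_degree d (fmul_conv d p q).
Proof.
move=> mp mq; have cd : (fmul_conv d p q)`_d = 1.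
  by have := @fmul_convE d p q 0 isT; rewrite subn0 => ->; rewrite bin0 !nesym0 // !mulr1.
have sz : size (fmul_conv d p q) = d.+1.
  apply/eqP; rewrite eqn_leq; apply/andP; split; last first.
    by rewrite ltnNge; apply/negP => /(nth_default 0)/eqP; rewrite cd oner_eq0.
  apply/leq_sizeP => j dj; rewrite coef_sum big1 // => i _.
  rewrite coefZ coefXn; case: eqP => [e|_]; last by rewrite mulr0.
  by move: dj; rewrite e; lia.
by split=> //; apply/monicP; rewrite lead_coefE sz.
Qed.

Section Identities.
Variables (d n : nat).
Hypotheses (n_gt0 : (0 < n)%N) (nd : (n <= d)%N).

Let d_gt0 : (0 < d)%N := leq_trans n_gt0 nd.
Let dR : d%:R != 0 :> R.
Proof. by rewrite pnatr_eq0 -lt0n. Qed.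
Let card_le_d (C : {set 'I_n}) : (#|C| <= d)%N.
Proof. by apply: leq_trans nd; rewrite -[X in (_ <= X)%N]card_ord max_card. Qed.

(** Both sides of the hypothesis of [transitive_sum_signed] equal
    d^k k! C(d, k) e_k(p) e_k(q) with k = |C|; the next two lemmas factor the
    corresponding expressions in the same way. *)
Lemma moment_fmul_conv p q : monic_degree d p -> monic_degree d q ->
  poly_moment d (fmul_conv d p q) n =
  transitive_sum n (- d%:R^-1) (poly_moment d p) (finite_free_cumulant d q).
Proof.
move=> mp mq; apply: (transitive_sum_signed n_gt0 dR) => C.
rewrite !perm_sum_moment // ?perm_sum_cumulant //; last exact: fmul_conv_monic_degree.
by rewrite nesym_fmul_conv //; ring.
Qed.

Lemma cumulant_fmul_conv p q : monic_degree d p -> monic_degree d q ->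
  finite_free_cumulant d (fmul_conv d p q) n =
  transitive_sum n (- d%:R^-1) (finite_free_cumulant d p) (finite_free_cumulant d q).
Proof.
move=> mp mq; apply: (transitive_sum_signed n_gt0 dR) => C.
rewrite !perm_sum_cumulant //; last exact: fmul_conv_monic_degree.
by rewrite nesym_fmul_conv //; ring.
Qed.

(** The constant sequence 1 plays the role of the moments of the unit (X - 1)^d of
    the convolution. *)
Lemma moment_of_cumulants p : monic_degree d p ->
  poly_moment d p n =
  transitive_sum n (- d%:R^-1) (finite_free_cumulant d p) (fun=> 1).
Proof.
move=> mp; apply: (transitive_sum_signed n_gt0 dR) => C.
by rewrite perm_sum_moment // perm_sum_cumulant // perm_sum_one; ring.
Qed.

End Identities.
End PolynomialIdentities.

From mathcomp Require Import all_classical all_reals all_analysis.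

Import numFieldNormedType.Exports.

Local Open Scope classical_set_scope.
Local Open Scope ring_scope.

(** * Calculus of first-order expansions *)

Section Expansions.
Variable R : realType.
Implicit Types (x y : nat -> R) (a b : R).

(** The form of [first_order_expansion] to which the limit theorems apply; see
    [first_order_expansionP]. *)
Definition expands x a b := d%:R * (x d - a) @[d --> \oo] --> b.

Lemma cvg_invn : (d%:R^-1 : R) @[d --> \oo] --> (0 : R).
Proof.
apply/gtr0_cvgV0; last exact: cvgr_idn.
by near=> d; rewrite ltr0n; near: d; exists 1%N.
Unshelve. all: by end_near. Qed.

Lemma expands_eq x y a b : (\forall d \near \oo, x d = y d) ->
  expands x a b -> expands y a b.
Proof.
move=> xy; apply: cvg_trans; apply: near_eq_cvg.
by near=> d; rewrite (near xy d).
Unshelve. all: by end_near. Qed.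

Lemma expands_cvg x a b : expands x a b -> x d @[d --> \oo] --> a.
Proof.
move=> h; have : d%:R^-1 * (d%:R * (x d - a)) + a @[d --> \oo] --> 0 * b + a.
  by apply: cvgD; [apply: cvgM; [exact: cvg_invn|exact: h]|exact: cvg_cst].
rewrite mul0r add0r; apply: cvg_trans; apply: near_eq_cvg; near=> d.
rewrite mulKf ?subrK // pnatr_eq0 -lt0n; near: d; by exists 1%N.
Unshelve. all: by end_near. Qed.

Lemma expands_cst a : expands (fun=> a) a 0.
Proof.
have : (fun=> 0 : R) @ \oo --> (0 : R) by exact: cvg_cst.
rewrite /expands; apply: cvg_trans; apply: near_eq_cvg; near=> d.
by rewrite subrr mulr0.
Unshelve. all: by end_near. Qed.

Lemma expandsD x y a b a' b' : expands x a b -> expands y a' b' ->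
  expands (fun d => x d + y d) (a + a') (b + b').
Proof.
move=> hx hy.
have : d%:R * (x d - a) + d%:R * (y d - a') @[d --> \oo] --> b + b'.
  exact: cvgD.
rewrite /expands; apply: cvg_trans; apply: near_eq_cvg; near=> d.
by ring.
Unshelve. all: by end_near. Qed.

(** The product rule, from xy - aa' = (x - a) y + a (y - a'). *)
Lemma expandsM x y a b a' b' : expands x a b -> expands y a' b' ->
  expands (fun d => x d * y d) (a * a') (b * a' + a * b').
Proof.
move=> hx hy; have cy := expands_cvg hy.
have : (d%:R * (x d - a)) * y d + a * (d%:R * (y d - a')) @[d --> \oo] --> b * a' + a * b'.
  apply: cvgD; first by apply: cvgM.
  by apply: cvgM => //; exact: cvg_cst.
by rewrite /expands; apply: cvg_trans; apply: near_eq_cvg; near=> d; ring.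
Unshelve. all: by end_near. Qed.

Lemma expands_inv : expands (fun d => - d%:R^-1) 0 (- 1).
Proof.
have : (fun=> -1 : R) @ \oo --> (-1 : R) by exact: cvg_cst.
rewrite /expands; apply: cvg_trans; apply: near_eq_cvg; near=> d.
rewrite subr0 mulrN divff // pnatr_eq0 -lt0n; near: d; by exists 1%N.
Unshelve. all: by end_near. Qed.

Lemma expandsZ c x a b : expands x a b -> expands (fun d => c * x d) (c * a) (c * b).
Proof. by move=> /(expandsM (expands_cst c)); rewrite mul0r add0r. Qed.

Lemma expandsX x a b k : expands x a b ->
  expands (fun d => x d ^+ k) (a ^+ k) (k%:R * a ^+ k.-1 * b).
Proof.
move=> h; elim: k => [|k IH]; first by rewrite !mul0r; exact: expands_cst.
have := expandsM h IH; rewrite -exprS.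
have -> : b * a ^+ k + a * (k%:R * a ^+ k.-1 * b) = k.+1%:R * a ^+ k.+1.-1 * b.
  by case: k {IH} => [|k]; rewrite /= ?exprS -?[k.+2]addn1 ?natrD; ring.
by apply: expands_eq; near=> d; rewrite exprS.
Unshelve. all: by end_near. Qed.

Lemma expands_sum (I : Type) (r : seq I) (P : pred I) (f : I -> nat -> R) (a b : I -> R) :
  (forall i, P i -> expands (f i) (a i) (b i)) ->
  expands (fun d => \sum_(i <- r | P i) f i d) (\sum_(i <- r | P i) a i)
    (\sum_(i <- r | P i) b i).
Proof.
move=> h; elim: r => [|i r IH].
  rewrite !big_nil; apply: expands_eq (expands_cst 0).
  by near=> d; rewrite big_nil.
rewrite !big_cons; case: ifP => Pi.
  by apply: expands_eq (expandsD (h i Pi) IH); near=> d; rewrite big_cons Pi.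
by apply: expands_eq IH; near=> d; rewrite big_cons Pi.
Unshelve. all: by end_near. Qed.

Lemma expands_div x y a b a' b' : a' != 0 -> expands x a b -> expands y a' b' ->
  expands (fun d => x d / y d) (a / a') ((b - a / a' * b') / a').
Proof.
move=> a0 hx hy; have cy := expands_cvg hy.
have : (d%:R * (x d - a) - a / a' * (d%:R * (y d - a'))) * (y d)^-1 @[d --> \oo] -->
    (b - a / a' * b') / a'.
  apply: cvgM; last exact: cvgV.
  by apply: cvgB => //; apply: cvgM => //; exact: cvg_cst.
rewrite /expands; apply: cvg_trans; apply: near_eq_cvg; near=> d.
have yd : y d != 0 by near: d; apply: cvgr_neq0 cy _.
by field; rewrite yd a0.
Unshelve. all: by end_near. Qed.

(** The product rule for a product over blocks, one block at a time. *)
Lemma expands_mult_ext (T : finType) (P : {set {set T}}) (u : nat -> nat -> R)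
    (a b : nat -> R) :
  (forall V : {set T}, V \in P -> expands (u^~ #|V|) (a #|V|) (b #|V|)) ->
  expands (fun d => mult_ext (u d) P) (mult_ext a P)
    (\sum_(V in P) b #|V| * mult_ext a (P :\ V)).
Proof.
move: {2}#|P| (leqnn #|P|) => m; elim: m P => [|m IH] P.
  rewrite leqn0 cards_eq0 => /eqP-> _; rewrite big_set0 /mult_ext big_set0.
  by apply: expands_eq (expands_cst 1); near=> d; rewrite big_set0.
move=> Pm h; have [->|/finset.set0Pn[V VP]] := eqVneq P finset.set0.
  rewrite big_set0 /mult_ext big_set0.
  by apply: expands_eq (expands_cst 1); near=> d; rewrite big_set0.
have Pm' : (#|P :\ V| <= m)%N by move: Pm; rewrite (cardsD1 V) VP.
have h' W : W \in P :\ V -> expands (u^~ #|W|) (a #|W|) (b #|W|).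
  by rewrite inE => /andP[_ /h].
have := expandsM (h V VP) (IH _ Pm' h').
have split w : mult_ext w P = w #|V| * mult_ext w (P :\ V) :> R.
  by rewrite /mult_ext (big_setD1 V).
rewrite -split (_ : _ + _ = \sum_(W in P) b #|W| * mult_ext a (P :\ W)).
  by apply: expands_eq; near=> d; rewrite split.
rewrite [RHS](big_setD1 V) //=; congr (_ + _); rewrite mulr_sumr.
apply: eq_bigr => W; rewrite !inE => /andP[WV WP].
rewrite mulrCA; congr (_ * _); rewrite [RHS](_ : _ = a #|V| * mult_ext a (P :\ W :\ V)).
  by congr (_ * mult_ext a _); apply/finset.setP => X; rewrite !inE andbCA.
by rewrite /mult_ext (big_setD1 V) //= !inE eq_sym WV VP.
Unshelve. all: by end_near. Qed.

End Expansions.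

(** * Moments and cumulants in the limit *)

Section Asymptotics.
Variable R : realType.

Lemma expands_val (x : nat -> R) (a b a' b' : R) :
  expands x a b -> a = a' -> b = b' -> expands x a' b'.
Proof. by move=> h <- <-. Qed.

(** The three parts of [transitive_sum_split] at y = -1/d: the first is
    differentiated block by block, in the second only the leading values matter
    because of the factor y, and the third has a factor y^2. *)
Lemma expands_transitive_sum n (u v : nat -> nat -> R) (a a' b b' : nat -> R) :
  (0 < n)%N ->
  (forall k, (0 < k)%N -> expands (u^~ k) (a k) (a' k)) ->
  (forall k, (0 < k)%N -> expands (v^~ k) (b k) (b' k)) ->
  expands (fun d => transitive_sum n (- d%:R^-1) (u d) (v d))
    (\sum_(P in NC n) mult_ext a P * mult_ext b (Kr P))
    (\sum_(P in NC n)
      (\sum_(V in P) a' #|V| * mult_ext a (P :\ V) * mult_ext b (Kr P)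
       + \sum_(W in Kr P) mult_ext a P * (b' #|W| * mult_ext b (Kr P :\ W)))
     - n%:R / 2 * \sum_(1 <= t < n) \sum_(s in SNC t (n - t)%N)
        mult_ext_perm a s * mult_ext_perm b (Kr_ann s) / (t%:R * (n - t)%N%:R)).
Proof.
move=> n0 hu hv.
have eu (T : finType) (P : {set {set T}}) (D : {set T}) : finset.partition P D ->
    expands (fun d => mult_ext (u d) P) (mult_ext a P)
      (\sum_(V in P) a' #|V| * mult_ext a (P :\ V)).
  by move=> pP; apply: expands_mult_ext => V VP; apply: hu; exact: card_block_gt0 pP VP.
have ev (T : finType) (P : {set {set T}}) (D : {set T}) : finset.partition P D ->
    expands (fun d => mult_ext (v d) P) (mult_ext b P)
      (\sum_(V in P) b' #|V| * mult_ext b (P :\ V)).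
  by move=> pP; apply: expands_mult_ext => V VP; apply: hv; exact: card_block_gt0 pP VP.
have euv (T : finType) (s t : {perm T}) := expandsM (eu _ _ _ (porbits_partition s))
  (ev _ _ _ (porbits_partition t)).
pose A (P : {set {set 'I_n}}) := mult_ext a P * mult_ext b (Kr P).
have e1 : expands (fun d => \sum_(P in NC n) mult_ext (u d) P * mult_ext (v d) (Kr P))
    (\sum_(P in NC n) A P)
    (\sum_(P in NC n)
      (\sum_(V in P) a' #|V| * mult_ext a (P :\ V) * mult_ext b (Kr P)
       + \sum_(W in Kr P) mult_ext a P * (b' #|W| * mult_ext b (Kr P :\ W)))).
  apply: expands_sum => P /NC_partition pP; rewrite -mulr_suml -mulr_sumr.
  exact: expandsM (eu _ _ _ pP) (ev _ _ _ (porbits_partition _)).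
have e2 := expandsM (@expands_inv R) (expandsZ (c := n%:R / 2) (expands_sum (r := index_iota 1 n) (P := xpredT)
  (fun t _ => expands_sum (r := index_enum 'S_(t + (n - t))) (P := fun s => s \in SNC t (n - t)%N)
    (fun s _ => expandsM (euv _ s (Kr_ann s)) (expands_cst ((t%:R * (n - t)%N%:R)^-1)))))).
have e3 := expandsM (expands_sum (r := index_enum ('S_n * 'S_n)%type)
  (P := fun st => transitive2 st.1 st.2 && (#|porbits st.1| + #|porbits st.2| < n)%N)
  (fun st _ => expandsM (expandsX (k := (n.+1 - (#|porbits st.1| + #|porbits st.2|))%N) (@expands_inv R))
     (euv _ st.1 st.2))) (expands_cst (n.-1`!%:R^-1)).
(* the exponent is at least 2, so these terms and their derivatives vanish *)
have exp2 (st : 'S_n * 'S_n) : (#|porbits st.1| + #|porbits st.2| < n)%N ->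
    exists k, (n.+1 - (#|porbits st.1| + #|porbits st.2|) = k.+2)%N.
  by move=> lt; exists (n.-1 - (#|porbits st.1| + #|porbits st.2|))%N; move: lt; card_lia.
apply: (expands_val (a := _) (b := _) (expands_eq _ (expandsD (expandsD e1 e2) e3))).
- by near=> d; rewrite transitive_sum_split.
- rewrite mul0r addr0 [X in _ + X / _]big1 ?mul0r ?addr0 // => st /andP[_ /exp2[k ->]].
  by rewrite exprS !mul0r.
rewrite mul0r !addr0 mulr0 addr0 [X in _ + X / _]big1 ?mul0r ?addr0 => [|st /andP[_ /exp2[k ->]]].
  by rewrite mulN1r.
by rewrite /= !exprS !(mul0r, mulr0) addr0.
Unshelve. all: by end_near. Qed.

Section Cumulants.
Variables (p : nat -> {poly R}) (m m' : nat -> R).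
Hypothesis p_monic : forall d, (0 < d)%N -> monic_degree d (p d).
Hypothesis p_moments : forall k, (0 < k)%N ->
  expands (fun d => poly_moment d (p d) k) (m k) (m' k).

Let kappa d := finite_free_cumulant d (p d).

(** The cumulant of index n is (moment - lower part)/(top coefficient); the lower
    part only involves cumulants of smaller index, and the top coefficient has a
    nonzero limit. *)
Lemma cumulant_expands_exists n : (0 < n)%N ->
  exists ab, expands (kappa^~ n) ab.1 ab.2.
Proof.
elim/ltn_ind: n => n IH n0.
have /choice[f hf] : forall k, exists ab, (0 < k < n)%N -> expands (kappa^~ k) ab.1 ab.2.
  move=> k; case: (boolP (0 < k < n)%N) => [/andP[k0 kn]|_]; last by exists (0, 0).
  by have [ab h] := IH k kn k0; exists ab.
have top := expandsM (expands_sum (r := index_enum ('S_n * 'S_n)%type)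
  (P := fun st => transitive2 st.1 st.2 && (#|porbits st.1| == 1%N))
  (fun st _ => expandsX (k := (n.+1 - (#|porbits st.1| + #|porbits st.2|))%N) (@expands_inv R)))
  (expands_cst (n.-1`!%:R^-1)).
have low := expandsM (expands_sum (r := index_enum ('S_n * 'S_n)%type)
  (P := fun st => transitive2 st.1 st.2 && (#|porbits st.1| != 1%N))
  (fun st h => expandsM
    (expandsX (k := (n.+1 - (#|porbits st.1| + #|porbits st.2|))%N) (@expands_inv R))
    (expands_mult_ext (P := porbits st.1) (u := kappa) (a := fun k => (f k).1) (b := fun k => (f k).2)
      (fun V VP => hf #|V| (introT andP (conj
         (card_block_gt0 (porbits_partition st.1) VP)
         (eq_ind _ (fun N => (#|V| < N)%N) (card_block_lt (porbits_partition st.1)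
           (eq_ind _ (fun b => ~~ b) (proj2 (andP h)) _ (card_porbits_eq1 st.1)) VP)
           _ (card_ord n))))))))
  (expands_cst (n.-1`!%:R^-1)).
have c0 := top_coefficient0_neq0 R n0.
have := expands_div c0 (expandsD (p_moments n0) (expandsZ (c := -1) low)) top.
move=> h; eexists (_, _); apply: expands_eq h; near=> d.
have nd : (n <= d)%N by near: d; exact: nbhs_infty_ge.
have d0 : (0 < d)%N by exact: leq_trans n0 nd.
rewrite (moment_of_cumulants n0 nd (p_monic d0)) transitive_sum_top mulN1r.
rewrite -[X in _ - X]/(lower_part n (- d%:R^-1) (kappa d)) addrK.
rewrite -[X in _ / X]/(top_coefficient n (- d%:R^-1)) mulfK //.
near: d; apply: cvgr_neq0 (expands_cvg top) _; exact: c0.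
Unshelve. all: by end_near. Qed.

(** In the limit the exact formula for moments becomes the moment-cumulant
    relation, which determines the limits of the cumulants. *)
Lemma cumulant_expands : exists k', forall n, (0 < n)%N ->
  expands (kappa^~ n) (free_cumulant m n) (k' n).
Proof.
have /choice[f hf] : forall k, exists ab, (0 < k)%N -> expands (kappa^~ k) ab.1 ab.2.
  move=> [|k]; first by exists (0, 0).
  by have [ab h] := cumulant_expands_exists (ltn0Sn k); exists ab.
exists (fun k => (f k).2) => n n0.
rewrite -(@free_cumulant_unique R m (fun k => (f k).1)) //; first exact: hf.
move=> k k0.
have h1 := expands_cvg (p_moments k0).
have h2 := expands_cvg (expands_transitive_sum (v := fun _ _ => 1) (b := fun=> 1) (b' := fun=> 0) k0 hf
  (fun k _ => expands_cst 1)).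
have h3 : (fun d => transitive_sum k (- d%:R^-1) (kappa d) (fun=> 1)) @ \oo --> m k.
  apply: cvg_trans h1; apply: near_eq_cvg; near=> d.
  have kd : (k <= d)%N by near: d; exact: nbhs_infty_ge.
  by rewrite (moment_of_cumulants k0 kd) //; apply: p_monic; exact: leq_trans k0 kd.
rewrite (cvg_unique _ h3 h2) //; apply: eq_bigr => P _.
by rewrite [X in _ * X]big1 ?mulr1.
Unshelve. all: by end_near. Qed.

End Cumulants.
End Asymptotics.

Section InfinitesimalSequences.
Variable R : realType.
Implicit Types (p q : nat -> {poly R}) (mu nu rho : probability (measurableTypeR R) R).

Lemma real_rooted_monic_degree d (P : {poly R}) : real_rooted d P -> monic_degree d P.
Proof. by case. Qed.

(** An expansion exists, so the chosen number is the coefficient of one. *)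
Lemma cumulant_fluctuationP q nu (nu' : {scalar {poly R}}) :
    (forall d, (0 < d)%N -> monic_degree d (q d)) -> has_inf_distribution q nu nu' ->
  forall n, (0 < n)%N ->
  expands (fun d => finite_free_cumulant d (q d) n) (free_cumulant_of nu n)
    (cumulant_fluctuation q nu n).
Proof.
move=> qm [_ _ _ qmom] n n0.
have [k' h] := cumulant_expands qm qmom.
apply/first_order_expansionP; rewrite /cumulant_fluctuation.
apply: (@getPex _ [set r | first_order_expansion
    (fun d => finite_free_cumulant d (q d) n) (free_cumulant_of nu n) r]).
by exists (k' n); apply/first_order_expansionP; exact: h.
Qed.

(** The moment of the finite convolution is written with the moments of p and the
    cumulants of q, and also with the cumulants of the convolution, whose limits
    are the free cumulants of rho.  Uniqueness of limits equates the two leading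
    terms. *)
Lemma moment_mul_conv p q mu nu rho (mu' nu' : {scalar {poly R}}) n :
    (forall d, (0 < d)%N -> monic_degree d (p d)) ->
    (forall d, (0 < d)%N -> monic_degree d (q d)) ->
    has_inf_distribution p mu mu' -> has_inf_distribution q nu nu' ->
    is_free_mul_conv mu nu rho -> (0 < n)%N ->
  moment rho n =
  \sum_(P in NC n) mult_ext (moment mu) P * mult_ext (free_cumulant_of nu) (Kr P).
Proof.
move=> pm qm pinf qinf [_ rho_conv] n0.
have kp := cumulant_fluctuationP pm pinf; have kq := cumulant_fluctuationP qm qinf.
have [_ _ _ pmom] := pinf.
have kpq k : (0 < k)%N -> exists b, expands
    (fun d => finite_free_cumulant d (fmul_conv d (p d) (q d)) k) (free_cumulant_of rho k) b.
  move=> k0; rewrite rho_conv //; eexists.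
  apply: expands_eq (expands_transitive_sum k0 kp kq); near=> d.
  have kd : (k <= d)%N by near: d; exact: nbhs_infty_ge.
  have d0 : (0 < d)%N by exact: leq_trans k0 kd.
  by rewrite (cumulant_fmul_conv k0 kd (pm d d0) (qm d d0)).
have /choice[b hb] : forall k, exists b, (0 < k)%N -> expands
    (fun d => finite_free_cumulant d (fmul_conv d (p d) (q d)) k) (free_cumulant_of rho k) b.
  by move=> [|k]; [exists 0 | have [b h] := kpq k.+1 isT; exists b].
have h1 := expands_cvg (expands_transitive_sum n0 pmom kq).
have h2 := expands_cvg (expands_transitive_sum (v := fun _ _ => 1) (b := fun=> 1)
  (b' := fun=> 0) n0 hb (fun k _ => expands_cst 1)).
rewrite (moment_free_cumulant (moment rho) n0).
transitivity (\sum_(P in NC n) mult_ext (free_cumulant_of rho) P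
   * mult_ext (fun=> 1) (Kr P)).
  by apply: eq_bigr => P _; rewrite [X in _ * X]big1 ?mulr1.
suff h3 : transitive_sum n (- d%:R^-1)
      (fun k => finite_free_cumulant d (fmul_conv d (p d) (q d)) k) (fun=> 1) @[d --> \oo] -->
    \sum_(P in NC n) mult_ext (moment mu) P * mult_ext (free_cumulant_of nu) (Kr P).
  exact: (cvg_unique _ h2 h3).
apply: cvg_trans h1; apply: near_eq_cvg; near=> d.
have nd : (n <= d)%N by near: d; exact: nbhs_infty_ge.
have d0 : (0 < d)%N by exact: leq_trans n0 nd.
rewrite -(moment_fmul_conv n0 nd (pm d d0) (qm d d0)).
by rewrite (moment_of_cumulants n0 nd (fmul_conv_monic_degree (pm d d0) (qm d d0))).
Unshelve. all: by end_near. Qed.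

End InfinitesimalSequences.

Theorem theorem3p6 (R : realType)
    (p q : nat -> {poly R})
    (mu nu rho : probability (measurableTypeR R) R)
    (mu' nu' : {scalar {poly R}})
    (p_real : forall d, (0 < d)%N -> real_rooted d (p d))
    (q_real : forall d, (0 < d)%N -> real_rooted d (q d))
    (mu_det : moment_determinate mu)
    (nu_det : moment_determinate nu)
    (p_inf : has_inf_distribution p mu mu')
    (q_inf : has_inf_distribution q nu nu')
    (nu_nneg : supported_nneg nu)
    (rho_conv : is_free_mul_conv mu nu rho)
    (n : nat) (n_gt0 : (0 < n)%N) :
  first_order_expansion
    (fun d => poly_moment d (fmul_conv d (p d) (q d)) n)
    (moment rho n)
    (inf_moment_mul_conv mu mu' q nu n).
Proof.
have pm d (d0 : (0 < d)%N) := real_rooted_monic_degree (p_real d d0).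
have qm d (d0 : (0 < d)%N) := real_rooted_monic_degree (q_real d d0).
have [_ _ _ pmom] := p_inf.
rewrite (moment_mul_conv pm qm p_inf q_inf rho_conv n_gt0).
apply/first_order_expansionP.
apply: expands_eq (expands_transitive_sum n_gt0 pmom (cumulant_fluctuationP qm q_inf)).
near=> d; have nd : (n <= d)%N by near: d; exact: nbhs_infty_ge.
have d0 : (0 < d)%N by exact: leq_trans n_gt0 nd.
by rewrite (moment_fmul_conv n_gt0 nd (pm d d0) (qm d d0)).
Unshelve. all: by end_near. Qed.
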